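(* Let $G$ be a cell complex given by a subset of the quadrilaterals of the $\mathbb{Z}^2$ lattice, with $G$ and its dual $G^*$ simply connected. Let $\mathcal{R}^\delta$, $\delta\in\mathbb{R}$, be a one-parameter family of orthogonal ring patterns on $G$ with $\rho$-radii $\rho_i^\delta=\rho_i+\delta$, $\rho_i\in\mathbb{R}$, scaled by the factor $2e^{-|\delta|}$, i.e. with radii $$r_i^\delta=2e^{-|\delta|}\sinh(\rho_i+\delta),\qquad R_i^\delta=2e^{-|\delta|}\cosh(\rho_i+\delta).$$ Then, on every compact subcomplex $G_0\subset G$ with $G_0$ and $G_0^*$ simply connected, in the limit $\delta\to+\infty$ we obtain an orthogonal circle pattern $\mathcal{C}$ with logarithmic radii $\rho_i$, and in the limit $\delta\to-\infty$ we obtain the dual circle pattern $\mathcal{C}^*$ with logarithmic radii $-\rho_i$ (with opposite orientation).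
   Context: **Complex.** $G$ is a cell complex defined by a subset of the quadrilaterals (unit squares) of the $\mathbb{Z}^2$ lattice in $\mathbb{R}^2$, with vertices $v_{m,n}$, $(m,n)\in\mathbb{Z}^2$, and horizontal edges $(v_{m,n},v_{m+1,n})$ and vertical edges $(v_{m,n},v_{m,n+1})$. Inner vertices have four neighbors; vertices with fewer neighbors are boundary vertices. The dual complex $G^*$ has the 2-cells of $G$ as vertices, and its edges correspond to the edges of $G$ shared by two neighboring 2-cells. **Rings.** A ring is a pair of concentric circles in $\mathbb{R}^2$: an inner circle $c$ of signed radius $r\in\mathbb{R}$ and an outer circle $C$ of radius $R>0$, the area being $\pi(R^2-r^2)$. $r>0$ corresponds to counter-clockwise and $r<0$ to clockwise orientation; if $r=0$ the inner circle degenerates to its center, and orthogonal intersection of $C'$ with $c$ means that $C'$ passes through that point. **Orthogonal ring pattern on $G$.** An assignment of rings to the vertices of $G$ (centers identified with vertices) such that: (i) rings at neighboring vertices $v_i,v_j$ intersect orthogonally, i.e. $C_i$ intersects $c_j$ orthogonally and $C_j$ intersects $c_i$ orthogonally; (ii) in each square of $G$ the inner circles $c_{m,n}$, $c_{m+1,n+1}$ and the outer circles $C_{m,n+1}$, $C_{m+1,n}$ pass through one point (then the two inner circles touch and the two outer circles touch at this point); (iii) for any ring $(C_{m,n},c_{m,n})$ the four touching points $C_{m,n}\cap C_{m+1,n-1}$, $c_{m,n}\cap c_{m+1,n+1}$, $C_{m,n}\cap C_{m-1,n+1}$, $c_{m,n}\cap c_{m-1,n-1}$ are in counter-clockwise order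 if $r_{m,n}>0$ and in clockwise order if $r_{m,n}<0$. **$\rho$-radii and the family.** All rings of an orthogonal ring pattern have the same area $\pi\ell_0^2$, so $R_i^2-r_i^2=\ell_0^2$; the $\rho$-radius $\rho_i\in\mathbb{R}$ is defined by $R_i=\ell_0\cosh\rho_i$, $r_i=\ell_0\sinh\rho_i$. If $\rho_i$ are the $\rho$-radii of an orthogonal ring pattern then so are $\rho_i+\delta$ for every $\delta\in\mathbb{R}$. Here $\ell_0=2e^{-|\delta|}$. A pattern is determined by its $\rho$-radii and $\ell_0$ up to Euclidean motion. **Orthogonal circle pattern (Schramm type).** An assignment of circles to the vertices of the complex such that circles at neighboring vertices intersect orthogonally and, in each square, the four circles pass through one point, the circles at opposite vertices of the square touching there; the angles at $v_i$ in the right-angled kites formed by the centers and intersection points of circles $i$ and $j$, for the neighbors $v_j$ of $v_i$, sum to $2\pi$ at interior vertices. If the radii are $e^{\rho_i}$, the $\rho_i$ are called logarithmic radii. The dual pattern $\mathcal{C}^*$ of an orthogonal circle pattern $\mathcal{C}$ with logarithmic radii $\rho_i$ is the orthogonal circle pattern with radii $e^{-\rho_i}$. **Limit.** The limit is understood in the sense that on $G_0$ the inner circle (in absolute value of its radius) and the outer circle of each ring converge to one and the same circle, the limit circles forming the stated circle pattern (patterns being considered up to Euclidean motion); ''opposite orientation'' means that the signed inner radii converge to $-e^{-\rho_i}$. *)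

(* Defs.v *)
From HB Require Import structures.
From mathcomp Require Export all_boot all_order all_algebra.
From mathcomp Require Export all_classical all_reals all_analysis.
Export Order.TTheory GRing.Theory Num.Theory.
Export numFieldNormedType.Exports.

Set Implicit Arguments.
Unset Strict Implicit.
Unset Printing Implicit Defensive.

Local Open Scope classical_set_scope.
Local Open Scope ring_scope.

Section Hyperbolic.
Context {R : realType}.

Definition sinh (x : R) : R := (expR x - expR (- x)) / 2.
Definition cosh (x : R) : R := (expR x + expR (- x)) / 2.

End Hyperbolic.

Section Plane.
Context {R : realType}.
Implicit Types u w x y z : R * R.

Definition dot u w : R := u.1 * w.1 + u.2 * w.2.
Definition cross u w : R := u.1 * w.2 - u.2 * w.1.

(* The library norm on [R * R] is the sup norm; this is the Euclidean one. *)
Definition enorm u : R := Num.sqrt (dot u u).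

Definition euclidean_motion (g : R * R -> R * R) : Prop :=
  forall x y, enorm (g x - g y) = enorm (x - y).

(* unsigned angle at [z] of the triangle [x z y] *)
Definition angle x z y : R :=
  acos (dot (x - z) (y - z) / (enorm (x - z) * enorm (y - z))).

(* Seen from [z], the points [x0, x1, x2, x3] are in strict counter-clockwise
   cyclic order. *)
Definition ccw_order z x0 x1 x2 x3 : Prop :=
  exists t0 t1 t2 t3 : R,
    [/\ t0 < t1, t1 < t2, t2 < t3 & t3 < t0 + 2 * pi] /\
    [/\ x0 - z = (enorm (x0 - z) * cos t0, enorm (x0 - z) * sin t0),
        x1 - z = (enorm (x1 - z) * cos t1, enorm (x1 - z) * sin t1),
        x2 - z = (enorm (x2 - z) * cos t2, enorm (x2 - z) * sin t2) &
        x3 - z = (enorm (x3 - z) * cos t3, enorm (x3 - z) * sin t3)].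

(* Seen from [z], the point [y] is reached from [x] by a counter-clockwise
   turn through an angle in ]0, pi[. *)
Definition ccw_turn z x y : Prop := 0 < cross (x - z) (y - z).

End Plane.

Section SimplyConnected.
Context {R : realType}.

Definition simply_connected (A : set (R * R)) : Prop :=
  [/\ A !=set0,
      (forall x y, A x -> A y -> exists f : R -> R * R,
         [/\ {within `[0, 1], continuous f}, f 0 = x, f 1 = y &
             forall t, 0 <= t <= 1 -> A (f t)]) &
      (forall f : R -> R * R,
         {within `[0, 1], continuous f} -> f 0 = f 1 ->
         (forall t, 0 <= t <= 1 -> A (f t)) ->
         exists H : R * R -> R * R,
           [/\ {within `[0, 1]%classic `*` `[0, 1]%classic, continuous H},
               (forall s t, 0 <= s <= 1 -> 0 <= t <= 1 -> A (H (s, t))),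
               (forall t, 0 <= t <= 1 -> H (0, t) = f t),
               (forall t, 0 <= t <= 1 -> H (1, t) = f 0) &
               (forall s, 0 <= s <= 1 -> H (s, 0) = f 0 /\ H (s, 1) = f 0)])].

End SimplyConnected.

(* A cell complex is given by the set [Q] of its squares; the pair [(m, n)]
   stands for the square [m, m+1] x [n, n+1] as well as for the vertex
   v_{m,n}, its lower left corner. *)
Section Complex.
Implicit Types (Q : set (int * int)) (i : int * int).

(* The four squares around the vertex [i], counter-clockwise from the lower
   right one, and the four lattice neighbours of [i], counter-clockwise from the
   right one.  Indices are modulo 4; the edge from [i] to [nb i k] separates
   [sq i k] from [sq i k.+1]. *)
Definition sq i (k : nat) : int * int :=
  let: (m, n) := i in
  nth (m, n) [:: (m, n - 1); (m, n); (m - 1, n); (m - 1, n - 1)] (k %% 4).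

Definition nb i (k : nat) : int * int :=
  let: (m, n) := i in
  nth (m, n) [:: (m + 1, n); (m, n + 1); (m - 1, n); (m, n - 1)] (k %% 4).

Definition vertex Q i : Prop := exists k, Q (sq i k).

Definition inner_vertex Q i : Prop := forall k, Q (sq i k).

(* [nb i k] is joined to [i] by an edge of the complex *)
Definition edge Q i (k : nat) : Prop := Q (sq i k) \/ Q (sq i k.+1).

Context (R : realType).

Definition body Q : set (R * R) :=
  [set x | exists m n : int,
     [/\ Q (m, n), m%:~R <= x.1 <= (m + 1)%:~R & n%:~R <= x.2 <= (n + 1)%:~R]].

(* The dual complex: a vertex for each square of [Q], an edge for any two squares
   of [Q] with a common edge, a 2-cell for any four squares of [Q] around an
   inner vertex.  The vertex dual to the square [(m, n)] is placed at the point
   (m, n) rather than at the centre of the square, so that the dual cells are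
   the products [m, m+a] x [n, n+b] with a, b in {0, 1}. *)
Definition dual_body Q : set (R * R) :=
  [set x | exists (m n : int) (a b : bool),
     [/\ forall c d : bool, (c <= a)%N -> (d <= b)%N ->
           Q (m + c%:Z, n + d%:Z),
         m%:~R <= x.1 <= (m + a%:Z)%:~R & n%:~R <= x.2 <= (n + b%:Z)%:~R]].

End Complex.
Arguments body : clear implicits.
Arguments dual_body : clear implicits.

Section Patterns.
Context {R : realType}.

(* The radius is signed: positive for the counter-clockwise, negative for the
   clockwise orientation; radius 0 is a point. *)
Record circle := Circle { ctr : R * R; rad : R }.

Definition on_circle (c : circle) (x : R * R) : Prop :=
  enorm (x - ctr c) = `|rad c|.

(* If [rad d = 0], this says that [c] passes through the point [ctr d]. *)
Definition orthogonal (c d : circle) : Prop :=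
  exists x, [/\ on_circle c x, on_circle d x & dot (x - ctr c) (x - ctr d) = 0].

(* Contact of oriented circles: with u the unit vector such that
   x = ctr c + rad c * u one has x = ctr d - rad d * u.  The contact is external
   if the radii have the same sign and internal if they have opposite signs. *)
Definition touch_at (c d : circle) (x : R * R) : Prop :=
  [/\ on_circle c x, on_circle d x,
      rad d * (x - ctr c).1 + rad c * (x - ctr d).1 = 0 &
      rad d * (x - ctr c).2 + rad c * (x - ctr d).2 = 0].

Record ring := Ring { center : R * R; rin : R; rout : R }.

Definition inner (a : ring) : circle := Circle (center a) (rin a).
Definition outer (a : ring) : circle := Circle (center a) (rout a).
Definition is_ring (a : ring) : Prop := 0 < rout a /\ `|rin a| < rout a.

(* [p (m, n)] is the common point of the four circles of the square [(m, n)].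
   The last two clauses are the orientation condition.  For a ring with four
   touching points it is the cyclic order of these points.  The last clause
   extends it to boundary rings, which have fewer touching points: consecutive
   ones, on either side of the edge from i to j, turn by the angle
   atan (R_j / r_i) + atan (r_j / R_i), which lies in ]0, pi[ if r_i > 0 and in
   ]-pi, 0[ if r_i < 0. *)
Definition ring_pattern (Q : set (int * int)) (a : int * int -> ring) : Prop :=
  (forall i, vertex Q i -> is_ring (a i)) /\
  (forall i k, edge Q i k ->
     orthogonal (outer (a i)) (inner (a (nb i k))) /\
     orthogonal (outer (a (nb i k))) (inner (a i))) /\
  exists p : int * int -> R * R,
    [/\ (forall m n : int, Q (m, n) ->
           touch_at (inner (a (m, n))) (inner (a (m + 1, n + 1))) (p (m, n)) /\
           touch_at (outer (a (m, n + 1))) (outer (a (m + 1, n))) (p (m, n))),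
        (forall i, inner_vertex Q i ->
           let z := center (a i) in
           (0 < rin (a i) ->
              ccw_order z (p (sq i 0)) (p (sq i 1)) (p (sq i 2)) (p (sq i 3))) /\
           (rin (a i) < 0 ->
              ccw_order z (p (sq i 3)) (p (sq i 2)) (p (sq i 1)) (p (sq i 0)))) &
        (forall i k, Q (sq i k) -> Q (sq i k.+1) ->
           let z := center (a i) in
           (0 < rin (a i) -> ccw_turn z (p (sq i k)) (p (sq i k.+1))) /\
           (rin (a i) < 0 -> ccw_turn z (p (sq i k.+1)) (p (sq i k))))].

(* Two squares with a common edge from [i] to [nb i k] yield the two intersection
   points [p (sq i k)] and [p (sq i k.+1)] of the circles at the ends of this
   edge; with the two centres they form a kite, whose angle at [i] is the
   summand of the last clause. *)
Definition circle_pattern (Q : set (int * int)) (C : int * int -> circle) :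
    Prop :=
  (forall i, vertex Q i -> 0 < rad (C i)) /\
  (forall i k, edge Q i k -> orthogonal (C i) (C (nb i k))) /\
  exists p : int * int -> R * R,
    [/\ (forall m n : int, Q (m, n) ->
           touch_at (C (m, n)) (C (m + 1, n + 1)) (p (m, n)) /\
           touch_at (C (m, n + 1)) (C (m + 1, n)) (p (m, n))),
        (forall i k, Q (sq i k) -> Q (sq i k.+1) ->
           p (sq i k) <> p (sq i k.+1)) &
        (forall i, inner_vertex Q i ->
           \sum_(k < 4)
             (angle (p (sq i k)) (ctr (C i)) (ctr (C (nb i k))) +
              angle (ctr (C (nb i k))) (ctr (C i)) (p (sq i k.+1))) = 2 * pi)].

Definition log_radii (Q : set (int * int)) (C : int * int -> circle)
    (rho : int * int -> R) : Prop :=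
  forall i, vertex Q i -> rad (C i) = expR (rho i).

Definition dual_pattern (Q : set (int * int)) (C D : int * int -> circle) :
    Prop :=
  [/\ circle_pattern Q C, circle_pattern Q D &
      forall rho, log_radii Q C rho -> log_radii Q D (fun i => - rho i)].

(* Up to Euclidean motions, along the filter [F], the inner and the outer circle
   of each ring on [Q] both converge to the circle [C i], the inner one with the
   orientation given by the sign [e]. *)
Definition ring_limit (F : set_system R) (Q : set (int * int))
    (a : R -> int * int -> ring) (e : R) (C : int * int -> circle) : Prop :=
  exists g : R -> R * R -> R * R,
    (forall delta, euclidean_motion (g delta)) /\
    forall i, vertex Q i ->
      [/\ g delta (center (a delta i)) @[delta --> F] --> ctr (C i),
          rin (a delta i) @[delta --> F] --> e * rad (C i) &
          rout (a delta i) @[delta --> F] --> rad (C i)].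

End Patterns.
Arguments circle : clear implicits.
Arguments ring : clear implicits.

(* Main.v *)
(* Let [p] be the common point of the four circles of a square.  Its four
   vectors to the centres have lengths |r|, R, |r|, R in turn, and consecutive
   ones are orthogonal, so up to the orientation in which the square is laid
   out, each is determined by the previous one and the radii.  The orientation
   condition on the touching points forces squares with a common edge to be laid
   out in the same orientation as soon as r <> 0.  After moving a base edge to
   the first axis, and reflecting if necessary, the pattern is therefore a
   continuous function of the radii along every path of adjacent squares, and
   connectedness of the dual complex gives convergence of all centres.  The limit
   configuration satisfies the same equations with |r| = R.  At an inner vertex
   the cyclic order of the touching points makes the four turning angles sum up
   to 2 pi, which passes to the limit since [acos] is continuous on ]-1, 1[; in
   the limit every turning angle is twice a half-angle of a kite. *)

Require Import Defs.
From mathcomp Require Import ring lra zify.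

Set Implicit Arguments.
Unset Strict Implicit.
Unset Printing Implicit Defensive.
Local Open Scope classical_set_scope.
Local Open Scope ring_scope.

(** * Combinatorics of the lattice *)

(* The corners of the square [q], counter-clockwise from the lower left one; [q]
   lies on the left of the edge from [corner q c] to [corner q c.+1]. *)
Definition corner (q : int * int) (c : nat) : int * int :=
  let: (m, n) := q in
  nth (m, n) [:: (m, n); (m + 1, n); (m + 1, n + 1); (m, n + 1)] (c %% 4).

Lemma nat_ind4 (P : nat -> Prop) :
  P 0%N -> P 1%N -> P 2%N -> P 3%N -> (forall k, P k -> P k.+4) ->
  forall k, P k.
Proof.
move=> P0 P1 P2 P3 PS; suff H k : [/\ P k, P k.+1, P k.+2 & P k.+3].
  by move=> k; case: (H k).
by elim: k => [|k [? ? ? ?]]; split => //; apply: PS.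
Qed.

Lemma modnS4 k : (k.+4 %% 4 = k %% 4)%N.
Proof. by rewrite -addn4 modnDr. Qed.

Lemma corner4 q c : corner q c.+4 = corner q c.
Proof. by rewrite /corner modnS4. Qed.

Lemma sq4 i k : sq i k.+4 = sq i k.
Proof. by rewrite /sq modnS4. Qed.

Lemma nb4 i k : nb i k.+4 = nb i k.
Proof. by rewrite /nb modnS4. Qed.

Lemma sq_corner q c : sq (corner q c) c.+1 = q.
Proof.
move: c; apply: nat_ind4 => [||||c IH]; last by rewrite corner4 sq4.
all: case: q => m n; rewrite /sq /corner /=; congr pair; lia.
Qed.

Lemma corner_sq i k : corner (sq i k.+1) k = i.
Proof.
move: k; apply: nat_ind4 => [||||k IH]; last by rewrite corner4 sq4.
all: case: i => m n; rewrite /sq /corner /=; congr pair; lia.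
Qed.

Lemma corner_sq_next i k : corner (sq i k.+1) k.+1 = nb i k.
Proof.
move: k; apply: nat_ind4 => [||||k IH]; last by rewrite corner4 sq4 nb4.
all: case: i => m n; rewrite /sq /corner /nb /=; congr pair; lia.
Qed.

Lemma sq_nb i k : sq (nb i k) k.+3 = sq i k.
Proof.
move: k; apply: nat_ind4 => [||||k IH]; last by rewrite nb4 !sq4.
all: case: i => m n; rewrite /sq /nb /=; congr pair; lia.
Qed.

Lemma sq_nb2 i k : sq (nb i k) k.+2 = sq i k.+1.
Proof.
move: k; apply: nat_ind4 => [||||k IH]; last by rewrite nb4 !sq4.
all: case: i => m n; rewrite /sq /nb /=; congr pair; lia.
Qed.

Lemma vertex_corner (Q : set (int * int)) q c : Q q -> vertex Q (corner q c).
Proof. by move=> Qq; exists c.+1; rewrite sq_corner. Qed.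

Lemma edge_corner (Q : set (int * int)) q c : Q q ->
  edge Q (corner q c) c /\ nb (corner q c) c = corner q c.+1.
Proof.
move=> Qq; split; first by right; rewrite sq_corner.
by rewrite -corner_sq_next sq_corner.
Qed.

Definition adjacent (Q : set (int * int)) (q q' : int * int) :=
  [/\ Q q, Q q' & exists i k, (q = sq i k /\ q' = sq i k.+1)].

Lemma adjacent_sym (Q : set (int * int)) q q' : adjacent Q q q' -> adjacent Q q' q.
Proof.
case=> Qq Qq' [i [k [eq eq']]]; split => //; exists (nb i k), k.+2.
by rewrite sq_nb2 sq_nb.
Qed.

(** Connectedness of the dual graph as an induction principle: what spreads to adjacent squares
    spreads from one square to all. *)
Definition dual_connected (Q : set (int * int)) : Prop :=
  forall (q q' : int * int) (S : set (int * int)), Q q -> Q q' -> S q ->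
  (forall x y, S x -> adjacent Q x y -> S y) -> S q'.

(** * Chains of adjacent squares from paths in the dual body *)

Section DualConnected.
Context (R : realType) (Q : set (int * int)).

Lemma adj_h m n : Q (m, n) -> Q (m + 1, n) -> adjacent Q (m, n) (m + 1, n).
Proof.
move=> H1 H2; apply: adjacent_sym; split => //; exists (m + 1, n), 1%N.
by rewrite /sq /=; split => //; congr pair; lia.
Qed.

Lemma adj_v m n : Q (m, n) -> Q (m, n + 1) -> adjacent Q (m, n) (m, n + 1).
Proof.
move=> H1 H2; split => //; exists (m, n + 1), 0%N.
by rewrite /sq /=; split => //; congr pair; lia.
Qed.

(** A horizontal and then a vertical step inside the cell join any two of its corners, so it does
    not matter at which corner [S] is tested. *)
Lemma cell_closed (S : set (int * int)) (m n : int) (a b : bool) :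
  (forall x y, S x -> adjacent Q x y -> S y) ->
  (forall c d : bool, (c <= a)%N -> (d <= b)%N -> Q (m + c%:Z, n + d%:Z)) ->
  forall c d c' d' : bool, (c <= a)%N -> (d <= b)%N -> (c' <= a)%N -> (d' <= b)%N ->
  S (m + c%:Z, n + d%:Z) -> S (m + c'%:Z, n + d'%:Z).
Proof.
move=> HS HQ c d c' d' ca db ca' db' Sc.
have h1 : S (m + c'%:Z, n + d%:Z).
  have := HQ c d ca db; have := HQ c' d ca' db.
  case: c c' ca ca' Sc {HQ} => [] [] // ca ca'; rewrite ?addr0 => S1 Q1 Q2.
    by apply: HS S1 _; apply: adjacent_sym; apply: adj_h.
  by apply: HS S1 _; apply: adj_h.
have := HQ c' d ca' db; have := HQ c' d' ca' db'.
case: d d' db db' h1 {HQ Sc} => [] [] // ca0 ca0'; rewrite ?addr0 => S1 Q1 Q2.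
  by apply: HS S1 _; apply: adjacent_sym; apply: adj_v.
by apply: HS S1 _; apply: adj_v.
Qed.

(** The end points are integers, so the strict bound gives [m <= m' + a'] and [m' <= m + a];
    intervals of length at most 1 then share an end point. *)
Lemma interval_meet (x y : R) (m m' : int) (a a' : bool) :
  m%:~R <= x <= (m + a%:Z)%:~R -> m'%:~R <= y <= (m' + a'%:Z)%:~R ->
  `|x - y| < 1 ->
  exists c c' : bool, [/\ (c <= a)%N, (c' <= a')%N & m + c%:Z = m' + c'%:Z].
Proof.
move=> /andP[x1 x2] /andP[y1 y2]; rewrite ltr_norml => /andP[h1 h2].
have e1 : (m%:~R : R) < (m' + a'%:Z + 1)%:~R by rewrite intrD; lra.
have e2 : (m'%:~R : R) < (m + a%:Z + 1)%:~R by rewrite intrD; lra.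
rewrite !ltr_int in e1 e2.
have [lt|gt|eq] := ltgtP m m'.
- exists true, false; case: a {x2 e1} e2 => //= e2; last by lia.
  by split => //; lia.
- exists false, true; case: a' {y2 e2} e1 => //= e1; last by lia.
  by split => //; lia.
by exists false, false; split => //; lia.
Qed.

(** Testing the base corner is enough: once [S] is closed under adjacency, it contains all squares
    of the cell. *)
Let covered (S : set (int * int)) : set (R * R) :=
  [set x | exists (m n : int) (a b : bool),
     [/\ forall c d : bool, (c <= a)%N -> (d <= b)%N ->
           Q (m + c%:Z, n + d%:Z),
         m%:~R <= x.1 <= (m + a%:Z)%:~R, n%:~R <= x.2 <= (n + b%:Z)%:~R
       & S (m, n)]].

(* Lattice cells that share no vertex are at sup distance at least 1. *)
Lemma covered_near S (x y : R * R) :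
  (forall x y, S x -> adjacent Q x y -> S y) ->
  covered S x -> dual_body R Q y -> ball x 1 y -> covered S y.
Proof.
move=> HS [m [n [a [b [Qx x1 x2 Sx]]]]] [m' [n' [a' [b' [Qy y1 y2]]]]] [b1 b2].
exists m', n', a', b'; split => //.
have [c [c' [ca ca' ec]]] := interval_meet x1 y1 b1.
have [d [d' [db db' ed]]] := interval_meet x2 y2 b2.
have := @cell_closed S m n a b HS Qx false false c d isT isT ca db.
rewrite !addr0 ec ed => /(_ Sx) S1.
have := @cell_closed S m' n' a' b' HS Qy c' d' false false ca' db' isT isT S1.
by rewrite !addr0.
Qed.

(** Along a path in the dual body the covered points form a relatively open and closed set by
    [covered_near]; the image of the path is connected, so its end point is covered too. *)
Lemma simply_connected_dual_connected :
  simply_connected (dual_body R Q) -> dual_connected Q.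
Proof.
move=> [_ path_conn _] q q' S Qq Qq' Sq HS.
pose pt (q : int * int) : R * R := (q.1%:~R, q.2%:~R).
have dpt z : Q z -> dual_body R Q (pt z).
  case: z => m n Qz; exists m, n, false, false; rewrite /= !addr0 !lexx; split => //.
  by case=> [] [] // _ _; rewrite !addr0.
have [f [fc f0 f1 fD]] := path_conn _ _ (dpt _ Qq) (dpt _ Qq').
pose I := f @` `[0, 1].
have conI : connected I.
  apply: connected_continuous_connected fc.
  exact: segment_connected.
have ID x : I x -> dual_body R Q x.
  by move=> [t]; rewrite /= in_itv /= => ht <-; apply: fD.
have Iq : I (pt q).
  by exists 0 => //; rewrite /= in_itv /= lexx ler01.
have Iq' : I (pt q').
  by exists 1 => //; rewrite /= in_itv /= lexx ler01.
have cq : covered S (pt q).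
  have [] // := dpt _ Qq.
  case: q Qq Sq {f0 Iq} => m n Qz Sz _ _; exists m, n, false, false.
  rewrite /= !addr0 !lexx; split => //.
  by case=> [] [] // _ _; rewrite !addr0.
have eqI : I `&` covered S = I.
  apply: conI.
  - by exists (pt q).
  - exists (\bigcup_(y in covered S) (ball y 1)°).
      by apply: bigcup_open => y _; exact: open_interior.
    apply/seteqP; split => x [Ix hx]; split => //.
      by exists x => //; exact: nbhsx_ballx.
    have [y cy xy] := hx; apply: (covered_near HS cy (ID _ Ix)).
    exact: interior_subset xy.
  (* Closedness: remove the unit balls around the uncovered points of the dual body. *)
  exists (~` \bigcup_(y in dual_body R Q `\` covered S) (ball y 1)°).
    by apply: open_closedC; apply: bigcup_open => y _; exact: open_interior.
  apply/seteqP; split => x [Ix hx]; split => //.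
    move=> [y [Dy ncy] xy]; apply: ncy; apply: (covered_near HS hx Dy).
    by apply: ball_sym; exact: interior_subset xy.
  apply: contrapT => ncx; apply: hx; exists x; first by split => //; exact: ID.
  exact: nbhsx_ballx.
have : covered S (pt q') by have : I (pt q') := Iq'; rewrite -eqI => -[].
move=> [m [n [a [b [QC x1 x2 Sx]]]]].
(* The covering cell may have another base; comparison with the degenerate interval at [pt q'] shows
   that [q'] is one of its corners. *)
have [c [c' [ca ca' ec]]] := @interval_meet _ (pt q').1 m q'.1 a false x1
  ltac:(by rewrite /= addr0 lexx) ltac:(by rewrite subrr normr0).
have [d [d' [db db' ed]]] := @interval_meet _ (pt q').2 n q'.2 b false x2
  ltac:(by rewrite /= addr0 lexx) ltac:(by rewrite subrr normr0).
have := @cell_closed S m n a b HS QC false false c d isT isT ca db.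
rewrite !addr0 ec ed => /(_ Sx); case: c' ca' {ec} => // _; case: d' db' {ed} => // _.
by rewrite !addr0; case: (q').
Qed.

End DualConnected.

(** * Squares of a ring pattern *)

Section PlaneGeometry.
Context {R : realType}.
Implicit Types (u v w x y z : R * R) (s : R).

Lemma enorm_ge0 u : 0 <= enorm u.
Proof. exact: sqrtr_ge0. Qed.

Lemma dot_ge0 u : 0 <= dot u u.
Proof. by rewrite /dot -!expr2 addr_ge0 // sqr_ge0. Qed.

Lemma sqr_enorm u : enorm u ^+ 2 = dot u u.
Proof. by rewrite sqr_sqrtr // dot_ge0. Qed.

Lemma enormE u (r : R) : dot u u = r ^+ 2 -> enorm u = `|r|.
Proof. by move=> h; rewrite /enorm h sqrtr_sqr. Qed.

Lemma dotC u v : dot u v = dot v u.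
Proof. by rewrite /dot; ring. Qed.

Lemma crossC u v : cross u v = - cross v u.
Proof. by rewrite /cross; ring. Qed.

Lemma crossNr u v : cross u (- v) = - cross u v.
Proof. by rewrite /cross /=; ring. Qed.

Lemma crossZr (k : R) u v : cross u (k *: v) = k * cross u v.
Proof. by rewrite /cross /= /GRing.scale /=; ring. Qed.

Lemma sqr_cross u v : cross u v ^+ 2 = dot u u * dot v v - dot u v ^+ 2.
Proof. by rewrite /dot /cross; ring. Qed.

Lemma on_circleP (c : circle R) x :
  on_circle c x <-> dot (x - ctr c) (x - ctr c) = rad c ^+ 2.
Proof.
rewrite /on_circle; split=> [h|/enormE //].
by rewrite -sqr_enorm h real_normK // num_real.
Qed.

Lemma orthogonal_dist (c d : circle R) : orthogonal c d ->
  dot (ctr c - ctr d) (ctr c - ctr d) = rad c ^+ 2 + rad d ^+ 2.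
Proof.
move=> [x [/on_circleP h1 /on_circleP h2 h3]]; rewrite -h1 -h2.
transitivity (dot (x - ctr c) (x - ctr c) + dot (x - ctr d) (x - ctr d)
   - 2 * dot (x - ctr c) (x - ctr d)); last by rewrite h3; ring.
by rewrite /dot /=; ring.
Qed.

(** Here [x] and [y] lead from a centre to the common points on either side of an edge, and [w] runs
    along the edge. Resolving [x] and [y] along and across [w] expresses the turn by the radii and
    the signs [s], [t] of the two squares. *)
Lemma turn_formula x y w (al be ga de s t : R) :
  dot x x = al ^+ 2 -> dot x (x - w) = 0 -> cross (x - w) x = s * ga * al ->
  dot y y = be ^+ 2 -> dot y (y - w) = 0 -> cross y (y - w) = t * be * de ->
  dot w w * cross x y = al * be * (t * al * de + s * ga * be).
Proof.
move=> x1 x2 x3 y1 y2 y3.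
have dx : dot w x = al ^+ 2 by rewrite -x1 -[RHS]subr0 -x2 /dot /=; ring.
have dy : dot w y = be ^+ 2 by rewrite -y1 -[RHS]subr0 -y2 /dot /=; ring.
have cx : cross w x = - (s * ga * al) by rewrite -x3 /cross /=; ring.
have cy : cross w y = t * be * de by rewrite -y3 /cross /=; ring.
have -> : dot w w * cross x y = dot w x * cross w y - cross w x * dot w y.
  by rewrite /dot /cross; ring.
by rewrite dx dy cx cy; ring.
Qed.

End PlaneGeometry.

(** * Signed radii and orientations of the squares of one pattern *)

Section FixedPattern.
Context {R : realType}.
Implicit Types (Q : set (int * int)) (a : int * int -> ring R).
Implicit Types (p : int * int -> R * R) (q i : int * int) (c k : nat).

(* The circles of a square through its common point are the inner ones at the
   even corners and the outer ones at the odd corners. *)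
Definition role c (b : ring R) : R := if odd c then rout b else rin b.

Definition ray a p q c : R * R := p q - center (a (corner q c)).

Definition rho_at a q c : R := role c (a (corner q c)).

(* If the radii are nonzero, the two sides of the test are equal up to sign. *)
Definition orient a p q : R :=
  if cross (ray a p q 0) (ray a p q 1) == rho_at a q 0 * rho_at a q 1
  then 1 else -1.

Definition touch_points Q a p : Prop := forall m n : int, Q (m, n) ->
  touch_at (inner (a (m, n))) (inner (a (m + 1, n + 1))) (p (m, n)) /\
  touch_at (outer (a (m, n + 1))) (outer (a (m + 1, n))) (p (m, n)).

Definition orthogonal_edges Q a : Prop := forall i k, edge Q i k ->
  orthogonal (outer (a i)) (inner (a (nb i k))) /\
  orthogonal (outer (a (nb i k))) (inner (a i)).

Lemma role4 c b : role c.+4 b = role c b.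
Proof. by rewrite /role /= !negbK. Qed.

Lemma role2 c b : role c.+2 b = role c b.
Proof. by rewrite /role /= !negbK. Qed.

Lemma rho_at4 a q c : rho_at a q c.+4 = rho_at a q c.
Proof. by rewrite /rho_at role4 corner4. Qed.

Lemma ray4 a p q c : ray a p q c.+4 = ray a p q c.
Proof. by rewrite /ray corner4. Qed.

Lemma ray_sqr Q a p q c : touch_points Q a p -> Q q ->
  dot (ray a p q c) (ray a p q c) = rho_at a q c ^+ 2.
Proof.
case: q => m n ht /ht [[/on_circleP h1 /on_circleP h2 _ _]
  [/on_circleP h3 /on_circleP h4 _ _]].
by move: c; apply: nat_ind4 => // c IH; rewrite ray4 rho_at4.
Qed.

Lemma ray_opp Q a p q c : touch_points Q a p -> Q q ->
  rho_at a q c.+2 *: ray a p q c = - (rho_at a q c *: ray a p q c.+2).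
Proof.
case: q => m n ht /ht [[_ _ h1 h2] [_ _ h3 h4]].
move: c; apply: nat_ind4 => [||||c IH]; last by rewrite !(ray4, rho_at4).
all: rewrite /ray /rho_at /role /corner /=; apply: injective_projections => /=.
- by apply/eqP; rewrite -addr_eq0; apply/eqP.
- by apply/eqP; rewrite -addr_eq0; apply/eqP.
- by apply/eqP; rewrite -addr_eq0; apply/eqP; rewrite addrC.
- by apply/eqP; rewrite -addr_eq0; apply/eqP; rewrite addrC.
- by apply/eqP; rewrite -addr_eq0; apply/eqP; rewrite addrC.
- by apply/eqP; rewrite -addr_eq0; apply/eqP; rewrite addrC.
- by apply/eqP; rewrite -addr_eq0; apply/eqP.
- by apply/eqP; rewrite -addr_eq0; apply/eqP.
Qed.

(** Orthogonality along the edge makes the distance of the centres the hypotenuse over the two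
    radii; the converse of Pythagoras puts the right angle at the common point. *)
Lemma ray_perp Q a p q c : orthogonal_edges Q a -> touch_points Q a p -> Q q ->
  dot (ray a p q c) (ray a p q c.+1) = 0.
Proof.
move=> ho ht Qq.
have [/ho + enb] := edge_corner c Qq; rewrite enb => -[orth1 orth2].
set zi := center (a (corner q c)); set zj := center (a (corner q c.+1)).
have dist : dot (zi - zj) (zi - zj) = rho_at a q c ^+ 2 + rho_at a q c.+1 ^+ 2.
  (* The parity of [c] decides which of the two orthogonality conditions of the edge concerns the
     circles through [p q]. *)
  rewrite /rho_at /role /=; case: (odd c).
    by have := orthogonal_dist orth1.
  have := orthogonal_dist orth2; rewrite [RHS]addrC => h; apply: etrans h.
  by rewrite /dot /=; ring.
have : dot (zi - zj) (zi - zj) = rho_at a q c ^+ 2 + rho_at a q c.+1 ^+ 2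
   - 2 * dot (ray a p q c) (ray a p q c.+1).
  by rewrite -!(ray_sqr _ ht Qq) /dot /ray /=; ring.
rewrite dist => /eqP; rewrite -subr_eq0 opprB addrC subrK mulf_eq0 pnatr_eq0 /=.
by move=> /eqP.
Qed.

(** At the first two corners the cross product of perpendicular rays is plus or minus the product of
    the radii, and [orient] records the sign. [ray_opp] carries this sign from corner to corner, as
    no radius vanishes. *)
Lemma ray_cross Q a p q c : orthogonal_edges Q a -> touch_points Q a p -> Q q ->
  (forall c, rho_at a q c != 0) ->
  cross (ray a p q c) (ray a p q c.+1) =
  orient a p q * rho_at a q c * rho_at a q c.+1.
Proof.
move=> ho ht Qq h0; elim: c => [|c IH].
  rewrite /orient; case: eqP => [->|/eqP hne]; first by rewrite mul1r.
  have : cross (ray a p q 0) (ray a p q 1) ^+ 2 == (rho_at a q 0 * rho_at a q 1) ^+ 2.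
    rewrite exprMn -!(ray_sqr _ ht Qq).
    by rewrite sqr_cross (ray_perp _ ho ht Qq) expr0n subr0.
  by rewrite eqf_sqr (negPf hne) /= => /eqP ->; rewrite !mulN1r mulNr.
apply: (mulfI (h0 c)).
have ro := ray_opp c ht Qq.
have -> : rho_at a q c * cross (ray a p q c.+1) (ray a p q c.+2) =
  cross (ray a p q c.+1) (rho_at a q c *: ray a p q c.+2).
  by rewrite crossZr.
rewrite -[X in cross _ X]opprK -ro.
transitivity (rho_at a q c.+2 * cross (ray a p q c) (ray a p q c.+1)).
  by rewrite crossNr crossZr [X in - (_ * X)]crossC mulrN opprK.
by rewrite IH; ring.
Qed.

Lemma orientP a p q : orient a p q = 1 \/ orient a p q = -1.
Proof. by rewrite /orient; case: ifP; [left|right]. Qed.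

Definition turns Q a p := forall i k, Q (sq i k) -> Q (sq i k.+1) ->
  let z := center (a i) in
  (0 < rin (a i) -> ccw_turn z (p (sq i k)) (p (sq i k.+1))) /\
  (rin (a i) < 0 -> ccw_turn z (p (sq i k.+1)) (p (sq i k))).

Lemma corner_sq_right i k : corner (sq i k) k.+3 = i.
Proof. by rewrite -sq4 corner_sq. Qed.

Lemma corner_sq_right_next i k : corner (sq i k) k.+2 = nb i k.
Proof. by rewrite -sq_nb corner_sq. Qed.

(** The product of outer radii, which carries [t], outweighs that of inner radii, whatever the sign
    [s]. *)
Lemma dominant_sign (r r' u u' s t : R) : `|r| < u -> `|r'| < u' ->
  s = 1 \/ s = -1 -> t = 1 \/ t = -1 -> 0 < t * u * u' + s * r * r' -> t = 1.
Proof.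
move=> hr hr' hs [//|->] h; exfalso; move: h; apply/negP; rewrite -leNgt.
have : `|r * r'| <= u * u'.
  by rewrite normrM; apply: ler_pM => //; apply: ltW.
rewrite ler_norml => /andP[h1 h2].
by case: hs => ->; lra.
Qed.

(** By [turn_formula] and the orientation condition, a signed product of outer radii plus a signed
    product of inner radii is positive. The sign at the outer radii is the orientation of one of the
    two squares, selected by the parity of [k]; only that one is determined. *)
Lemma orient_turn Q a p i k :
  (forall i, vertex Q i -> is_ring (a i)) ->
  orthogonal_edges Q a -> touch_points Q a p -> turns Q a p ->
  Q (sq i k) -> Q (sq i k.+1) ->
  (forall c, rho_at a (sq i k) c != 0) -> (forall c, rho_at a (sq i k.+1) c != 0) ->
  orient a p (if odd k then sq i k else sq i k.+1) = 1.
Proof.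
move=> hr ho ht htu Q1 Q2 n1 n2.
have x1 := ray_sqr k.+3 ht Q1.
have x2 := ray_perp k.+2 ho ht Q1.
have x3 := ray_cross k.+2 ho ht Q1 n1.
have y1 := ray_sqr k ht Q2.
have y2 := ray_perp k ho ht Q2.
have y3 := ray_cross k ho ht Q2 n2.
have ni := n2 k.
move: x1 x2 x3 y1 y2 y3 ni.
rewrite /rho_at /ray corner_sq_right corner_sq_right_next corner_sq corner_sq_next.
rewrite dotC !role2.
set j := nb i k; set x := p (sq i k) - center (a i).
set y := p (sq i k.+1) - center (a i).
pose w := center (a j) - center (a i).
have -> : p (sq i k) - center (a j) = x - w.
  by rewrite /x /w opprB addrA subrK.
have -> : p (sq i k.+1) - center (a j) = y - w.
  by rewrite /y /w opprB addrA subrK.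
move=> x1 x2 x3 y1 y2 y3 ni.
have [Ri ri] : is_ring (a i) by apply: hr; exists k.
have [Rj rj] : is_ring (a j).
  by apply: hr; exists k.+2; rewrite sq_nb2.
have ww : 0 < dot w w.
  have e : dot w w = dot y y + dot (y - w) (y - w) - 2 * dot y (y - w).
    by rewrite /dot /=; ring.
  rewrite e y2 mulr0 subr0 ltr_wpDr ?dot_ge0 //.
  by rewrite y1 exprn_even_gt0.
have tf := turn_formula x1 x2 x3 y1 y2 y3.
have [t1 t2] := htu _ _ Q1 Q2.
have rn0 : rin (a i) != 0.
  have := n1 k.+3; have := n2 k.
  rewrite /rho_at corner_sq_right corner_sq role2 /role /=.
  by case: (odd k).
(* Both cases of the orientation condition in one: the turn has the sign of [rin (a i)]. *)
have key : 0 < rin (a i) * cross x y.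
  have [pos|neg|eq0] := ltgtP (rin (a i)) 0.
  - have := t2 pos; rewrite /ccw_turn -/x -/y crossC oppr_gt0 => h.
    by rewrite nmulr_rgt0.
  - by rewrite pmulr_rgt0 //; apply: t1.
  by rewrite eq0 eqxx in rn0.
have key2 : 0 < rin (a i) * (role k.+1 (a i) * role k (a i) *
  (orient a p (sq i k.+1) * role k.+1 (a i) * role k.+1 (a j) +
   orient a p (sq i k) * role k (a j) * role k (a i))).
  by rewrite -tf mulrCA mulr_gt0.
have rR : 0 < rin (a i) * (rout (a i) * rin (a i)).
  by rewrite mulrCA mulr_gt0 // -expr2 exprn_even_gt0.
have os := orientP a p (sq i k); have ot := orientP a p (sq i k.+1).
move: key2; rewrite /role /=; case: (odd k) => /= key2.
  move: key2; rewrite [rin _ * rout _]mulrC mulrA pmulr_rgt0 // addrC => key2.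
  by apply: (dominant_sign rj ri ot os); rewrite [X in _ + X]mulrAC.
move: key2; rewrite mulrA pmulr_rgt0 // => key2.
by apply: (dominant_sign ri rj os ot); rewrite [X in _ + X]mulrAC.
Qed.

(** Seen from the other end of the edge, in direction [k.+2], the two squares change places while
    the parity stays, so [orient_turn] settles the remaining square. *)
Lemma orient_edge Q a p i k :
  (forall i, vertex Q i -> is_ring (a i)) ->
  orthogonal_edges Q a -> touch_points Q a p -> turns Q a p ->
  Q (sq i k) -> Q (sq i k.+1) ->
  (forall c, rho_at a (sq i k) c != 0) -> (forall c, rho_at a (sq i k.+1) c != 0) ->
  orient a p (sq i k) = 1 /\ orient a p (sq i k.+1) = 1.
Proof.
move=> hr ho ht htu Q1 Q2 n1 n2.
have h1 := orient_turn hr ho ht htu Q1 Q2 n1 n2.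
have := @orient_turn Q a p (nb i k) k.+2 hr ho ht htu.
rewrite sq_nb sq_nb2 /= negbK => /(_ Q2 Q1 n2 n1) h2.
by move: h1 h2; case: odd.
Qed.

End FixedPattern.

(** * Motions and angles *)

Section Motions.
Context {R : realType}.
Implicit Types (u v w x y z : R * R) (t : R).

Definition rot90 u : R * R := (- u.2, u.1).

(* Takes [z] to the origin and the direction of [w] to that of the first axis,
   reversing the orientation if [t = -1]. *)
Definition motion z w t x : R * R :=
  (dot w (x - z) / enorm w, t * cross w (x - z) / enorm w).

Lemma lagrange w u v :
  dot w u * dot w v + cross w u * cross w v = dot w w * dot u v.
Proof. by rewrite /dot /cross; ring. Qed.

Lemma motion_dot z w t x y x' y' : 0 < dot w w -> t = 1 \/ t = -1 ->
  dot (motion z w t x - motion z w t y) (motion z w t x' - motion z w t y') =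
  dot (x - y) (x' - y').
Proof.
move=> w0 ht; have en : enorm w != 0.
  by rewrite gt_eqF // /enorm sqrtr_gt0.
have tt : t * t = 1 by case: ht => ->; rewrite ?mulrNN mulr1.
apply: (mulfI (lt0r_neq0 w0)); rewrite -[RHS]lagrange -[in LHS]sqr_enorm.
have dl u v : dot w u - dot w v = dot w (u - v) by rewrite /dot /=; ring.
have cl u v : cross w u - cross w v = cross w (u - v) by rewrite /cross /=; ring.
have e u v : u - z - (v - z) = u - v :> R * R by rewrite opprB addrA subrK.
rewrite {1}/dot /motion /= -!mulrBl dl e dl e -!mulrBr cl e cl e.
rewrite -[in RHS](mul1r (cross w _)) -[in RHS]tt.
by field.
Qed.

Lemma motion_cross z w t x y x' y' : 0 < dot w w ->
  cross (motion z w t x - motion z w t y) (motion z w t x' - motion z w t y') =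
  t * cross (x - y) (x' - y').
Proof.
move=> w0; have en : enorm w != 0.
  by rewrite gt_eqF // /enorm sqrtr_gt0.
apply: (mulfI (lt0r_neq0 w0)).
transitivity (t * (dot w (x - y) * cross w (x' - y')
    - cross w (x - y) * dot w (x' - y'))); last first.
  by rewrite /dot /cross; ring.
rewrite -[in LHS]sqr_enorm.
have dl u v : dot w u - dot w v = dot w (u - v) by rewrite /dot /=; ring.
have cl u v : cross w u - cross w v = cross w (u - v) by rewrite /cross /=; ring.
have e u v : u - z - (v - z) = u - v :> R * R by rewrite opprB addrA subrK.
rewrite {1}/cross /motion /= -!mulrBl !dl !e -!mulrBr !cl !e.
by field.
Qed.

Lemma motion_euclidean z w t : 0 < dot w w -> t = 1 \/ t = -1 ->
  euclidean_motion (motion z w t).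
Proof. by move=> w0 ht x y; rewrite /enorm motion_dot. Qed.

(** The legs fix the components of the apex along and across the base, which makes it an explicit
    continuous function of base and radii. *)
Lemma kite_apex x w (al be : R) : al ^+ 2 + be ^+ 2 != 0 ->
  dot x x = al ^+ 2 -> dot (x - w) (x - w) = be ^+ 2 -> dot x (x - w) = 0 ->
  cross x (x - w) = al * be ->
  x = (al ^+ 2 + be ^+ 2)^-1 *: (al ^+ 2 *: w + (al * be) *: rot90 w).
Proof.
move=> n0 h1 h2 h3 h4.
have dx : dot w x = al ^+ 2 by rewrite -h1 -[RHS]subr0 -h3 /dot /=; ring.
have cx : cross w x = al * be by rewrite -h4 /cross /=; ring.
have ww : dot w w = al ^+ 2 + be ^+ 2.
  rewrite -h1 -h2; transitivity (dot x x + dot (x - w) (x - w) - 2 * dot x (x - w)).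
    by rewrite /dot /=; ring.
  by rewrite h3; ring.
apply: (scalerI n0); rewrite scalerA mulfV // scale1r -ww -dx -cx.
apply: injective_projections; rewrite /= /GRing.scale /= /dot /cross; ring.
Qed.

Lemma perp_scale x y (al be : R) : al != 0 ->
  dot x x = al ^+ 2 -> dot x y = 0 -> cross x y = al * be ->
  y = (be / al) *: rot90 x.
Proof.
move=> n0 h1 h2 h3; have n2 : al ^+ 2 != 0 by rewrite expf_neq0.
apply: (scalerI n2); rewrite scalerA.
have -> : al ^+ 2 * (be / al) = al * be by field.
rewrite -h1 -h3; apply: injective_projections; rewrite /= /GRing.scale /=.
  transitivity (x.1 * dot x y - x.2 * cross x y); last by rewrite h2; ring.
  by rewrite /dot /cross; ring.
transitivity (x.2 * dot x y + x.1 * cross x y); last by rewrite h2; ring.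
by rewrite /dot /cross; ring.
Qed.

End Motions.

Section Angles.
Context {R : realType}.
Implicit Types (u v w x y z : R * R) (s t : R).

Lemma angleC x z y : angle x z y = angle y z x.
Proof. by rewrite /angle dotC [enorm (x - z) * _]mulrC. Qed.

(** The difference [t - s] lies between 0 and [2 * pi] and has positive sine by the turn, so it is
    at most [pi], where [acos] inverts [cos]. *)
Lemma ccw_angle z x y s t : s < t -> t < s + 2 * pi ->
  x - z = (enorm (x - z) * cos s, enorm (x - z) * sin s) ->
  y - z = (enorm (y - z) * cos t, enorm (y - z) * sin t) ->
  ccw_turn z x y -> angle x z y = t - s.
Proof.
rewrite /ccw_turn /angle; move: (x - z) (y - z) => u v st ts hu hv.
set n := enorm u in hu *; set m := enorm v in hv *.
have -> : cross u v = n * m * sin (t - s).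
  by rewrite hu hv /cross /= sinB; ring.
have -> : dot u v = n * m * cos (t - s).
  by rewrite hu hv /dot /= cosB; ring.
have [->|nm0] := eqVneq (n * m) 0; first by rewrite mul0r ltxx.
have nm : 0 < n * m by rewrite lt_def nm0 mulr_ge0 // enorm_ge0.
rewrite pmulr_rgt0 // => sin0.
rewrite mulrAC divff // mul1r cosK // in_itv /= subr_ge0 ltW //=.
rewrite leNgt; apply/negP => h.
have : 0 < sin (t - s - pi) by apply: sin_gt0_pi; apply/andP; split; lra.
by rewrite sinB cospi sinpi; lra.
Qed.

(** The four differences telescope once the first direction is repeated as [t0 + 2 * pi]. *)
Lemma ccw_angle_sum z x0 x1 x2 x3 : ccw_order z x0 x1 x2 x3 ->
  ccw_turn z x0 x1 -> ccw_turn z x1 x2 -> ccw_turn z x2 x3 -> ccw_turn z x3 x0 ->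
  angle x0 z x1 + angle x1 z x2 + angle x2 z x3 + angle x3 z x0 = 2 * pi.
Proof.
move=> [t0 [t1 [t2 [t3 [[h01 h12 h23 h30] [e0 e1 e2 e3]]]]]] c01 c12 c23 c30.
have p0 := pi_gt0 R.
have e0' : x0 - z = (enorm (x0 - z) * cos (t0 + 2 * pi),
                     enorm (x0 - z) * sin (t0 + 2 * pi)).
  by rewrite mulr_natl cosD2pi sinD2pi.
rewrite (ccw_angle _ _ e0 e1 c01) ?(ccw_angle _ _ e1 e2 c12); try lra.
rewrite (ccw_angle _ _ e2 e3 c23) ?(ccw_angle _ _ e3 e0' c30); lra.
Qed.

Lemma acos_double (c : R) : 0 <= c <= 1 -> acos (2 * c ^+ 2 - 1) = 2 * acos c.
Proof.
move=> /andP[c0 c1].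
have c11 : -1 <= c <= 1 by rewrite c1 andbT; lra.
have [/andP[a0 api] ca] := acos_def c11.
have ap : acos c <= pi / 2.
  rewrite leNgt; apply/negP => h.
  have : 0 < cos (pi - acos c).
    by apply: cos_gt0_pihalf; have := pi_gt0 R => p0; apply/andP; split; lra.
  by rewrite cosB cospi sinpi ca; lra.
rewrite -[RHS]cosK; last by rewrite in_itv /=; lra.
by rewrite [2 * acos c]mulr_natl cos_mulr2n ca mulr_natl.
Qed.

(** The points [p] and [p'] lie on either side of the axis from [z] to [z'], both at the angle of
    cosine [r / L]. [lagrange] yields the cosine of the whole angle, and [acos_double] identifies it
    as the double. *)
Lemma kite_angle z z' p p' (r r' : R) : 0 < r -> 0 < r' ->
  dot (p - z) (p - z) = r ^+ 2 -> dot (p' - z) (p' - z) = r ^+ 2 ->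
  dot (z' - z) (z' - z) = r ^+ 2 + r' ^+ 2 ->
  dot (z' - z) (p - z) = r ^+ 2 -> dot (z' - z) (p' - z) = r ^+ 2 ->
  cross (z' - z) (p - z) * cross (z' - z) (p' - z) = - (r * r') ^+ 2 ->
  angle p z p' = angle p z z' + angle z' z p'.
Proof.
move=> r0 r0' xx yy ww wx wy wxy.
rewrite [angle p z z']angleC /angle wx wy.
rewrite (enormE xx) (enormE yy) (gtr0_norm r0).
have w0 : 0 < dot (z' - z) (z' - z) by rewrite ww; nra.
set L := enorm (z' - z).
have L0 : 0 < L by rewrite /L /enorm sqrtr_gt0.
have L2 : L ^+ 2 = r ^+ 2 + r' ^+ 2 by rewrite sqr_enorm.
have -> : dot (p - z) (p' - z) = (r ^+ 4 - (r * r') ^+ 2) / L ^+ 2.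
  have l0 := lt0r_neq0 w0; rewrite L2 -ww; apply: (mulfI l0).
  by rewrite -lagrange wx wy wxy; field.
have -> : r ^+ 2 / (L * r) = r / L by field; rewrite !gt_eqF.
rewrite -mulr2n -mulr_natl -acos_double.
  congr acos; have -> : (r * r') ^+ 2 = r ^+ 2 * (L ^+ 2 - r ^+ 2).
    by rewrite L2; ring.
  by field; rewrite !gt_eqF.
apply/andP; split; first by apply: divr_ge0; apply: ltW.
rewrite ler_pdivrMr // mul1r -ler_sqr ?nnegrE ?(ltW r0) ?(ltW L0) //.
by rewrite L2 lerDl sqr_ge0.
Qed.

End Angles.

(** * Limits of squares *)

Section LaidOut.
Context {R : realType}.
Implicit Types (rh : nat -> R) (P : R * R) (z : nat -> R * R).

(* [z 0, z 1, z 2, z 3] are the centres of the circles at the corners of a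
   square, counter-clockwise, [P] is their common point and [rh] lists the
   signed radii; all three are periodic in the index. *)
Definition laid_out rh P z : Prop := forall c,
  [/\ dot (P - z c) (P - z c) = rh c ^+ 2, dot (P - z c) (P - z c.+1) = 0 &
      cross (P - z c) (P - z c.+1) = rh c * rh c.+1].

Lemma laid_out_apex rh P z c : laid_out rh P z -> rh c != 0 ->
  P = z c + (rh c ^+ 2 + rh c.+1 ^+ 2)^-1 *: (rh c ^+ 2 *: (z c.+1 - z c) +
      (rh c * rh c.+1) *: rot90 (z c.+1 - z c)).
Proof.
move=> h c0; have [h1 h2 h3] := h c; have [h4 _ _] := h c.+1.
have e : P - z c - (z c.+1 - z c) = P - z c.+1 by rewrite opprB addrA subrK.
rewrite -[LHS](subrK (z c)) addrC; congr (_ + _).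
apply: kite_apex; rewrite ?e //.
by rewrite gt_eqF // ltr_wpDr ?sqr_ge0 // exprn_even_gt0.
Qed.

Lemma laid_out_next rh P z c : laid_out rh P z -> rh c != 0 ->
  P - z c.+1 = (rh c.+1 / rh c) *: rot90 (P - z c).
Proof. by move=> h c0; have [h1 h2 h3] := h c; apply: perp_scale. Qed.

Lemma rot90Z (k : R) u : rot90 (k *: u) = k *: rot90 u.
Proof.
by apply: injective_projections; rewrite /= /GRing.scale //= mulrN.
Qed.

Lemma rot90K (u : R * R) : rot90 (rot90 u) = - u.
Proof. by apply: injective_projections. Qed.

Lemma laid_out_prev rh P z c : laid_out rh P z -> rh c != 0 -> rh c.+1 != 0 ->
  P - z c = - ((rh c / rh c.+1) *: rot90 (P - z c.+1)).
Proof.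
move=> h c0 c1; rewrite (laid_out_next h c0) rot90Z rot90K !scalerN opprK scalerA.
by rewrite mulrA divfK // divff // scale1r.
Qed.

Lemma laid_out_opp rh P z c : laid_out rh P z -> rh c != 0 -> rh c.+1 != 0 ->
  P - z c.+2 = - ((rh c.+2 / rh c) *: (P - z c)).
Proof.
move=> h c0 c1; rewrite (laid_out_next h c1) (laid_out_next h c0).
by rewrite rot90Z rot90K !scalerN scalerA mulrA divfK.
Qed.

End LaidOut.

Section Limits.
Context {R : realType} {T : Type} {F : set_system T} {FF : ProperFilter F}.
Implicit Types (u v : T -> R * R) (l m : R * R).

Lemma cvg_coord1 u l : u @ F --> l -> (u d).1 @[d --> F] --> l.1.
Proof. by move=> h; apply: cvg_comp h _; exact: cvg_fst. Qed.

Lemma cvg_coord2 u l : u @ F --> l -> (u d).2 @[d --> F] --> l.2.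
Proof. by move=> h; apply: cvg_comp h _; exact: cvg_snd. Qed.

Lemma cvg_dot u v l m : u @ F --> l -> v @ F --> m ->
  dot (u d) (v d) @[d --> F] --> dot l m.
Proof.
move=> hu hv; apply: cvgD; apply: cvgM.
- exact: cvg_coord1 hu.
- exact: cvg_coord1 hv.
- exact: cvg_coord2 hu.
- exact: cvg_coord2 hv.
Qed.

Lemma cvg_cross u v l m : u @ F --> l -> v @ F --> m ->
  cross (u d) (v d) @[d --> F] --> cross l m.
Proof.
move=> hu hv; apply: cvgB; apply: cvgM.
- exact: cvg_coord1 hu.
- exact: cvg_coord2 hv.
- exact: cvg_coord2 hu.
- exact: cvg_coord1 hv.
Qed.

Lemma cvg_rot90 u l : u @ F --> l -> rot90 (u d) @[d --> F] --> rot90 l.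
Proof.
move=> hu; apply: (cvg_pair (cvgN (cvg_coord2 hu)) (cvg_coord1 hu)).
Qed.

Lemma cvg_enorm u l : u @ F --> l -> enorm (u d) @[d --> F] --> enorm l.
Proof.
move=> hu; apply: cvg_comp (cvg_dot hu hu) _.
exact: sqrt_continuous.
Qed.

Lemma cvg_near_eq (V : topologicalType) (f h : T -> V) (l : V) :
  (\forall d \near F, f d = h d) -> f @ F --> l -> h @ F --> l.
Proof.
move=> e hf; apply: cvg_trans hf; apply: near_eq_cvg.
by apply: filterS e => d ->.
Qed.

Lemma cvg_eq_lim (f h : T -> R) (l m : R) :
  (\forall d \near F, f d = h d) -> f @ F --> l -> h @ F --> m -> l = m.
Proof.
move=> e hf hh; apply: (cvg_unique _ _ hh) => //.
exact: cvg_near_eq e hf.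
Qed.

(** A nonzero cross product keeps the limit cosine strictly between -1 and 1, where [acos] is
    continuous. *)
Lemma cvg_angle (x z y : T -> R * R) (x' z' y' : R * R) :
  x @ F --> x' -> z @ F --> z' -> y @ F --> y' -> cross (x' - z') (y' - z') != 0 ->
  angle (x d) (z d) (y d) @[d --> F] --> angle x' z' y'.
Proof.
move=> hx hz hy c0.
rewrite /angle; move: c0; set u := x' - z'; set v := y' - z' => c0.
have hu : x d - z d @[d --> F] --> u by exact: cvgB.
have hv : y d - z d @[d --> F] --> v by exact: cvgB.
have := sqr_cross u v; rewrite -!sqr_enorm -exprMn => sc.
have c2 : 0 < cross u v ^+ 2 by rewrite exprn_even_gt0.
have n0 : 0 < enorm u * enorm v.
  rewrite lt_def mulr_ge0 ?enorm_ge0 // andbT; apply/eqP => h.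
  by rewrite h expr0n /= in sc; have := sqr_ge0 (dot u v); lra.
have lim : dot (x d - z d) (y d - z d) / (enorm (x d - z d) * enorm (y d - z d))
    @[d --> F] --> dot u v / (enorm u * enorm v).
  apply: cvgM; first exact: (cvg_dot hu hv).
  apply: cvgV; first by rewrite gt_eqF.
  by apply: cvgM; [exact: (cvg_enorm hu)|exact: (cvg_enorm hv)].
apply: cvg_comp lim _; apply: continuous_acos.
rewrite -ltr_norml normrM normfV [`|enorm u * _|]gtr0_norm //.
rewrite ltr_pdivrMr // mul1r.
rewrite -(ltr_sqr (_ : `|_| \is Num.nneg)) ?nnegrE ?(ltW n0) // real_normK ?num_real //.
lra.
Qed.

(** * Convergence within one square *)

Context (rh : T -> nat -> R) (P : T -> R * R) (z : T -> nat -> R * R) (rl : nat -> R).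
Context (laid : \forall d \near F, laid_out (rh d) (P d) (z d)).
Context (rh_cvg : forall c, rh d c @[d --> F] --> rl c).
Context (rl_neq0 : forall c, rl c != 0).

Let rh_neq0 c : \forall d \near F, rh d c != 0.
Proof. exact: (cvgr_neq0 (rl c) (@rh_cvg c) (rl_neq0 c)). Qed.

Definition converges (f : T -> R * R) : Prop := exists l, f @ F --> l.

Lemma laid_out_cvg_apex c :
  converges (z^~ c) -> converges (z^~ c.+1) -> converges P.
Proof.
move=> [l0 h0] [l1 h1].
have e : \forall d \near F, z d c + (rh d c ^+ 2 + rh d c.+1 ^+ 2)^-1 *:
   (rh d c ^+ 2 *: (z d c.+1 - z d c) +
      (rh d c * rh d c.+1) *: rot90 (z d c.+1 - z d c)) = P d.
  by apply: (filterS2 _ _ laid (rh_neq0 c)) => d h c0; rewrite -(laid_out_apex h c0).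
have sq k : rh d k ^+ 2 @[d --> F] --> rl k ^+ 2.
  exact: (cvg_comp _ _ (@rh_cvg k) (@exprn_continuous _ 2 (rl k))).
have w : z d c.+1 - z d c @[d --> F] --> l1 - l0 by exact: cvgB.
eexists; apply: cvg_near_eq e _.
apply: cvgD; first exact: h0.
apply: cvgZ.
  apply: cvgV; last by apply: cvgD; exact: sq.
  rewrite gt_eqF // ltr_wpDr ?sqr_ge0 // exprn_even_gt0 //=; exact: rl_neq0.
apply: cvgD; apply: cvgZ.
- exact: sq.
- exact: w.
- by apply: cvgM.
- exact: cvg_rot90 w.
Qed.

Lemma laid_out_cvg_next c :
  converges P -> converges (z^~ c) -> converges (z^~ c.+1).
Proof.
move=> [l hP] [l0 h0].
have e : \forall d \near F, P d - (rh d c.+1 / rh d c) *: rot90 (P d - z d c) = z d c.+1.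
  apply: (filterS2 _ _ laid (rh_neq0 c)) => d h c0.
  by rewrite -(laid_out_next h c0) opprB addrC subrK.
eexists; apply: cvg_near_eq e _.
apply: cvgB; first exact: hP.
apply: cvgZ; first by apply: cvgM => //; apply: cvgV.
by apply: cvg_rot90; apply: cvgB; [exact: hP|exact: h0].
Qed.

Lemma laid_out_cvg_prev c :
  converges P -> converges (z^~ c.+1) -> converges (z^~ c).
Proof.
move=> [l hP] [l0 h0].
have e : \forall d \near F, P d + (rh d c / rh d c.+1) *: rot90 (P d - z d c.+1) = z d c.
  apply: (filterS3 _ _ laid (rh_neq0 c) (rh_neq0 c.+1)) => d h c0 c1.
  by rewrite -[_ *: _]opprK -(laid_out_prev h c0 c1) opprB addrC subrK.
eexists; apply: cvg_near_eq e _.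
apply: cvgD; first exact: hP.
apply: cvgZ; first by apply: cvgM => //; apply: cvgV.
by apply: cvg_rot90; apply: cvgB; [exact: hP|exact: h0].
Qed.

(** One edge determines the common point, and rescaled quarter turns about it determine all
    corners. *)
Lemma laid_out_cvg c : converges (z^~ c) -> converges (z^~ c.+1) ->
  converges P /\ forall k, converges (z^~ k).
Proof.
move=> h0 h1; have hP := laid_out_cvg_apex h0 h1; split => //.
(* Descend to corner 0 first, so that the induction upwards reaches every index. *)
have hz : converges (z^~ 0%N).
  by elim: c h0 {h1} => // c IH /(laid_out_cvg_prev hP).
by elim=> // k IH; apply: laid_out_cvg_next.
Qed.

Lemma laid_out_lim Pl zl : P @ F --> Pl -> (forall k, z d k @[d --> F] --> zl k) ->
  laid_out rl Pl zl.
Proof.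
move=> hP hz c.
have v k : P d - z d k @[d --> F] --> Pl - zl k.
  by apply: cvgB; [exact: hP|exact: hz].
split.
- apply: (cvg_eq_lim _ (cvg_dot (v c) (v c))); last first.
    by rewrite expr2; apply: (cvgM (@rh_cvg c) (@rh_cvg c)).
  by apply: filterS laid => d h; have [-> _ _] := h c; rewrite expr2.
- apply: (cvg_eq_lim _ (cvg_dot (v c) (v c.+1)) (cvg_cst 0)).
  by apply: filterS laid => d h; have [_ -> _] := h c.
- apply: (cvg_eq_lim _ (cvg_cross (v c) (v c.+1)) (cvgM (@rh_cvg c) (@rh_cvg c.+1))).
  by apply: filterS laid => d h; have [_ _ ->] := h c.
Qed.

End Limits.

(** * The limit circle pattern *)

Section CirclePattern.
Context {R : realType} (eps : R) (e : int * int -> R).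
Implicit Types (q i : int * int) (c k : nat).

(** The limits of [rho_at]: [eps] is the limiting orientation of the inner circles. *)
Definition role_radius q c : R :=
  if odd c then e (corner q c) else eps * e (corner q c).

Context (Q : set (int * int)) (Z P : int * int -> R * R).
Context (eps1 : eps = 1 \/ eps = -1) (e0 : forall i, 0 < e i).
Context (laid : forall q, Q q ->
  laid_out (role_radius q) (P q) (fun c => Z (corner q c))).

Lemma role_radius_neq0 q c : role_radius q c != 0.
Proof.
have ec := lt0r_neq0 (e0 (corner q c)).
rewrite /role_radius; case: (odd c) => //; rewrite mulf_neq0 //.
by case: eps1 => ->; rewrite ?oppr_eq0 oner_eq0.
Qed.

Lemma role_radius_sqr q c : role_radius q c ^+ 2 = e (corner q c) ^+ 2.
Proof.
rewrite /role_radius; case: (odd c) => //; rewrite exprMn.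
by case: eps1 => ->; rewrite ?sqrrN expr1n mul1r.
Qed.

Lemma role_radius_mul q c : role_radius q c * role_radius q c.+1 =
  eps * (e (corner q c) * e (corner q c.+1)).
Proof. by rewrite /role_radius /=; case: (odd c) => /=; ring. Qed.

Lemma role_radius_div2 q c :
  role_radius q c.+2 / role_radius q c = e (corner q c.+2) / e (corner q c).
Proof.
have ec := lt0r_neq0 (e0 (corner q c)).
rewrite /role_radius /= negbK; case: (odd c) => //.
by case: eps1 => ->; field; rewrite ec.
Qed.

Lemma laid_norm q c : Q q ->
  dot (P q - Z (corner q c)) (P q - Z (corner q c)) = e (corner q c) ^+ 2.
Proof. by move=> /laid /(_ c) [-> _ _]; exact: role_radius_sqr. Qed.

Lemma laid_perp q c : Q q ->
  dot (P q - Z (corner q c)) (P q - Z (corner q c.+1)) = 0.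
Proof. by move=> /laid /(_ c) [_ -> _]. Qed.

Lemma laid_cross q c : Q q ->
  cross (P q - Z (corner q c)) (P q - Z (corner q c.+1)) =
  eps * (e (corner q c) * e (corner q c.+1)).
Proof. by move=> /laid /(_ c) [_ _ ->]; exact: role_radius_mul. Qed.

(** The common point is resolved along and across the edge. In [edge_left] only the sign of the
    cross product changes: the two common points are mirror images in the edge. *)
Lemma edge_right i k : Q (sq i k) ->
  let x := P (sq i k) - Z i in let w := Z (nb i k) - Z i in
  [/\ dot x x = e i ^+ 2, dot w x = e i ^+ 2, dot w w = e i ^+ 2 + e (nb i k) ^+ 2 &
      cross w x = - (eps * (e i * e (nb i k)))].
Proof.
move=> Qq; have := laid_norm k.+3 Qq; have := laid_norm k.+2 Qq.
have := laid_perp k.+2 Qq; have := laid_cross k.+2 Qq.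
rewrite corner_sq_right corner_sq_right_next => h1 h2 h3 h4 x w.
have ex : P (sq i k) - Z (nb i k) = x - w by rewrite /x /w opprB addrA subrK.
rewrite ex -/x in h1 h2 h3 h4.
have wx : dot w x = e i ^+ 2.
  by rewrite -h4 -[RHS]subr0 -h2 /dot /=; ring.
split => //.
  have -> : dot w w = dot (x - w) (x - w) + 2 * dot w x - dot x x.
    by rewrite /dot /=; ring.
  by rewrite h3 wx h4; ring.
by rewrite [e i * _]mulrC -h1 /cross /=; ring.
Qed.

Lemma edge_left i k : Q (sq i k.+1) ->
  let y := P (sq i k.+1) - Z i in let w := Z (nb i k) - Z i in
  [/\ dot y y = e i ^+ 2, dot w y = e i ^+ 2, dot w w = e i ^+ 2 + e (nb i k) ^+ 2 &
      cross w y = eps * (e i * e (nb i k))].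
Proof.
move=> Qq; have := laid_norm k Qq; have := laid_norm k.+1 Qq.
have := laid_perp k Qq; have := laid_cross k Qq.
rewrite corner_sq corner_sq_next => h1 h2 h3 h4 y w.
have ey : P (sq i k.+1) - Z (nb i k) = y - w by rewrite /y /w opprB addrA subrK.
rewrite ey -/y in h1 h2 h3 h4.
have wy : dot w y = e i ^+ 2.
  by rewrite -h4 -[RHS]subr0 -h2 /dot /=; ring.
split => //.
  have -> : dot w w = dot (y - w) (y - w) + 2 * dot w y - dot y y.
    by rewrite /dot /=; ring.
  by rewrite h3 wy h4; ring.
by rewrite -h1 /cross /=; ring.
Qed.

Lemma eps_neq0 : eps != 0.
Proof. by case: eps1 => ->; rewrite ?oppr_eq0 oner_eq0. Qed.

(** With inner and outer radii equal in absolute value, the two terms of the turn identity coincide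
    and add up to twice [eps * (e i ^+ 3 * e (nb i k))]. *)
Lemma edge_turn_neq0 i k : Q (sq i k) -> Q (sq i k.+1) ->
  cross (P (sq i k) - Z i) (P (sq i k.+1) - Z i) != 0.
Proof.
move=> Q1 Q2; have [x1 x2 x3 x4] := edge_right Q1; have [y1 y2 y3 y4] := edge_left Q2.
set x := _ - _ in x1 x2 x4 *; set y := P (sq i k.+1) - _ in y1 y2 y4 *.
set w := Z _ - _ in x2 x3 x4 y2 y3 y4.
have h : dot w w * cross x y = dot w x * cross w y - cross w x * dot w y.
  by rewrite /dot /cross; ring.
apply/eqP => c0; move: h; rewrite c0 mulr0 x2 y2 x4 y4 => /esym/eqP.
have -> : e i ^+ 2 * (eps * (e i * e (nb i k))) -
    - (eps * (e i * e (nb i k))) * e i ^+ 2 = eps * (2 * (e i ^+ 3 * e (nb i k))).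
  by ring.
rewrite mulf_eq0 (negPf eps_neq0) /= gt_eqF // mulr_gt0 // mulr_gt0 //.
exact: exprn_gt0.
Qed.

Lemma laid_touch q c : Q q ->
  touch_at (Circle (Z (corner q c)) (e (corner q c)))
    (Circle (Z (corner q c.+2)) (e (corner q c.+2))) (P q).
Proof.
move=> Qq; have ec := lt0r_neq0 (e0 (corner q c)).
have := laid_out_opp (laid Qq) (role_radius_neq0 q c) (role_radius_neq0 q c.+1).
(* Opposite corners have the same role, so [eps] cancels and the contact is that of circles of
   positive radius. *)
rewrite role_radius_div2 => opp.
have opp1 := congr1 fst opp; have opp2 := congr1 snd opp.
split; [apply/on_circleP; exact: laid_norm|apply/on_circleP; exact: laid_norm| |].
  by move: opp1 => /= ->; rewrite /GRing.scale /=; field.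
by move: opp2 => /= ->; rewrite /GRing.scale /=; field.
Qed.

Lemma laid_out_circle_pattern :
  (forall i, inner_vertex Q i ->
     \sum_(k < 4) angle (P (sq i k)) (Z i) (P (sq i k.+1)) = 2 * pi) ->
  circle_pattern Q (fun i => Circle (Z i) (e i)).
Proof.
move=> hsum; split; first by move=> i _; exact: e0.
split.
  move=> i k [Q1|Q2].
    exists (P (sq i k)); split; [apply/on_circleP|apply/on_circleP|] => /=.
    - by have := laid_norm k.+3 Q1; rewrite corner_sq_right.
    - by have := laid_norm k.+2 Q1; rewrite corner_sq_right_next.
    - have := laid_perp k.+2 Q1.
      by rewrite corner_sq_right_next corner_sq_right dotC.
  exists (P (sq i k.+1)); split; [apply/on_circleP|apply/on_circleP|] => /=.
  - by have := laid_norm k Q2; rewrite corner_sq.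
  - by have := laid_norm k.+1 Q2; rewrite corner_sq_next.
  - by have := laid_perp k Q2; rewrite corner_sq corner_sq_next.
exists P; split.
- move=> m n Qq.
  (* Index 3 gives [(m, n + 1)] first, as in the definition; its opposite index 5 wraps around to
     corner 1. *)
  by split; [exact: (laid_touch 0 Qq) | exact: (laid_touch 3 Qq)].
- move=> i k Q1 Q2 eqP; have := edge_turn_neq0 Q1 Q2.
  by rewrite eqP /cross mulrC subrr eqxx.
(* Each turning angle splits into the two half-angles of the kite over the edge. *)
move=> i Qi; rewrite -(hsum i Qi); apply: eq_bigr => k _; apply: esym.
have [x1 x2 x3 x4] := edge_right (Qi k); have [y1 y2 _ y4] := edge_left (Qi k.+1).
apply: (kite_angle (e0 i) (e0 (nb i k))) => //=.
rewrite x4 y4 mulNr; congr (- _).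
by case: eps1 => ->; ring.
Qed.

End CirclePattern.

(** For a negative inner radius the order and the turns are reversed together; the unsigned angle is
    symmetric, so the sum is the same. *)
Lemma ring_angle_sum {R : realType} (Q : set (int * int)) (a : int * int -> ring R)
    (p : int * int -> R * R) i : inner_vertex Q i ->
  (0 < rin (a i) ->
     ccw_order (center (a i)) (p (sq i 0)) (p (sq i 1)) (p (sq i 2)) (p (sq i 3))) ->
  (rin (a i) < 0 ->
     ccw_order (center (a i)) (p (sq i 3)) (p (sq i 2)) (p (sq i 1)) (p (sq i 0))) ->
  turns Q a p -> rin (a i) != 0 ->
  \sum_(k < 4) angle (p (sq i k)) (center (a i)) (p (sq i k.+1)) = 2 * pi.
Proof.
move=> Qi h1 h2 ht r0.
have t k := ht i k (Qi k) (Qi k.+1).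
rewrite !big_ord_recr big_ord0 /= add0r sq4.
have [lt|gt|eq] := ltgtP (rin (a i)) 0; last by rewrite eq eqxx in r0.
  have u k : ccw_turn (center (a i)) (p (sq i k.+1)) (p (sq i k)).
    by have [_ /(_ lt)] := t k.
  have := ccw_angle_sum (h2 lt) (u 2) (u 1%N) (u 0%N) (u 3).
  move=> <-; rewrite [in RHS](angleC (p (sq i 3))) (angleC (p (sq i 2)) _ (p (sq i 1))).
  rewrite (angleC (p (sq i 1)) _ (p (sq i 0))) (angleC (p (sq i 0)) _ (p (sq i 3))).
  by ring.
have u k : ccw_turn (center (a i)) (p (sq i k)) (p (sq i k.+1)).
  by have [/(_ gt)] := t k.
by have := ccw_angle_sum (h1 gt) (u 0%N) (u 1%N) (u 2) (u 3).
Qed.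

(** * Convergence of the family *)

Section Family.
Context {R : realType} (F : set_system R) {FF : ProperFilter F}.
Context (Q Q0 : set (int * int)) (sub : Q0 `<=` Q) (conn : dual_connected Q0).
Context (a : R -> int * int -> ring R) (p : R -> int * int -> R * R).
Context (eps : R) (e : int * int -> R).
Context (hring : forall d i, vertex Q i -> is_ring (a d i)).
Context (hedge : forall d, orthogonal_edges Q (a d)).
Context (htouch : forall d, touch_points Q (a d) (p d)).
Context (hturn : forall d, turns Q (a d) (p d)).
Context (horder : forall d i, inner_vertex Q i ->
  (0 < rin (a d i) -> ccw_order (center (a d i))
     (p d (sq i 0)) (p d (sq i 1)) (p d (sq i 2)) (p d (sq i 3))) /\
  (rin (a d i) < 0 -> ccw_order (center (a d i))
     (p d (sq i 3)) (p d (sq i 2)) (p d (sq i 1)) (p d (sq i 0)))).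
Context (eps1 : eps = 1 \/ eps = -1) (e0 : forall i, 0 < e i).
Context (hrin : forall i, vertex Q0 i -> rin (a d i) @[d --> F] --> eps * e i).
Context (hrout : forall i, vertex Q0 i -> rout (a d i) @[d --> F] --> e i).

Lemma rho_at_cvg q c : Q0 q -> rho_at (a d) q c @[d --> F] --> role_radius eps e q c.
Proof.
move=> Qq; have v := vertex_corner c Qq.
by rewrite /rho_at /role /role_radius; case: (odd c); [exact: hrout|exact: hrin].
Qed.

Lemma near_rho_at_neq0 q : Q0 q -> \forall d \near F, forall c, rho_at (a d) q c != 0.
Proof.
move=> Qq.
have n c : \forall d \near F, rho_at (a d) q c != 0.
  exact: (cvgr_neq0 _ (@rho_at_cvg q c Qq) (role_radius_neq0 eps1 e0 q c)).
have n01 : F [set d | rho_at (a d) q 0 != 0 /\ rho_at (a d) q 1 != 0].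
  exact: (filterI (n 0%N) (n 1%N)).
have n23 : F [set d | rho_at (a d) q 2 != 0 /\ rho_at (a d) q 3 != 0].
  exact: (filterI (n 2) (n 3)).
apply: (filterS2 _ _ n01 n23) => d [n0 n1] [n2 n3].
by apply: nat_ind4 => // c; rewrite rho_at4.
Qed.

Context (g : R -> R * R -> R * R) (tau : R -> R).
Context (gdot : forall d x y x' y',
  dot (g d x - g d y) (g d x' - g d y') = dot (x - y) (x' - y')).
Context (gcross : forall d x y x' y',
  cross (g d x - g d y) (g d x' - g d y') = tau d * cross (x - y) (x' - y')).

Let Z d i := g d (center (a d i)).
Let P d q := g d (p d q).

(** The invariant carried from square to square. Orientations are compared with [tau], since on the
    base square the value 1 is not guaranteed. *)
Let good q := [/\ \forall d \near F, orient (a d) (p d) q = tau d,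
  converges (F := F) (P^~ q) &
  forall c, converges (F := F) (fun d => Z d (corner q c))].

Lemma near_laid_out q : Q0 q -> (\forall d \near F, orient (a d) (p d) q = tau d) ->
  \forall d \near F, laid_out (rho_at (a d) q) (P d q) (fun c => Z d (corner q c)).
Proof.
move=> Qq; move=> nt; apply: (filterS2 _ _ (near_rho_at_neq0 Qq) nt) => d n0 ot c.
have Qq' := sub Qq; split.
- by rewrite gdot; exact: (ray_sqr c (@htouch d) Qq').
- by rewrite gdot; exact: (ray_perp c (@hedge d) (@htouch d) Qq').
rewrite gcross; have := ray_cross c (@hedge d) (@htouch d) Qq' n0.
rewrite /ray => ->; rewrite ot.
(* The motion contributes one factor [tau d] and the orientation of the square another; they
   cancel. *)
have tt : tau d * tau d = 1.
  by rewrite -ot; case: (orientP (a d) (p d) q) => ->; rewrite ?mulrNN mulr1.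
by rewrite !mulrA tt mul1r.
Qed.

Lemma good_of_edge q c : Q0 q -> (\forall d \near F, orient (a d) (p d) q = tau d) ->
  converges (F := F) (fun d => Z d (corner q c)) ->
  converges (F := F) (fun d => Z d (corner q c.+1)) -> good q.
Proof.
move=> Qq ot h0 h1.
have [hP hZ] := laid_out_cvg (near_laid_out Qq ot)
  (fun c => @rho_at_cvg q c Qq) (role_radius_neq0 eps1 e0 q) h0 h1.
by split.
Qed.

Lemma good_adjacent q q' : good q -> adjacent Q0 q q' -> good q'.
Proof.
move=> [ot _ hZ] [Qq Qq' [i [k [eq eq']]]].
apply: (@good_of_edge _ k Qq').
(* Both orientations are eventually 1, so that of [q'] agrees with [tau] because that of [q]
   does. *)
- apply: (filterS3 _ _ ot (near_rho_at_neq0 Qq) (near_rho_at_neq0 Qq')) => d.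
  rewrite eq eq' in Qq Qq' * => <- n1 n2.
  have [-> ->] // := orient_edge (@hring d) (@hedge d) (@htouch d) (@hturn d)
    (sub Qq) (sub Qq') n1 n2.
- by have := hZ k.+3; rewrite eq eq' corner_sq corner_sq_right.
- by have := hZ k.+2; rewrite eq eq' corner_sq_next corner_sq_right_next.
Qed.

Lemma angle_motion d x z y : angle (g d x) (g d z) (g d y) = angle x z y.
Proof. by rewrite /angle /enorm !gdot. Qed.

Lemma family_limit q0 : Q0 q0 -> good q0 ->
  exists C : int * int -> circle R,
    [/\ circle_pattern Q0 C, (forall i, rad (C i) = e i) &
        forall i, vertex Q0 i ->
        [/\ g d (center (a d i)) @[d --> F] --> ctr (C i),
            rin (a d i) @[d --> F] --> eps * rad (C i) &
            rout (a d i) @[d --> F] --> rad (C i)]].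
Proof.
move=> Qq0 good0.
have all_good q : Q0 q -> good q.
  by move=> Qq; apply: (conn Qq0 Qq good0) => x y; exact: good_adjacent.
(* Off the vertices of [Q0] the limit is the dummy value 0; a vertex [i] is corner [k.+3] of
   [sq i k]. *)
have Zex i : exists l : R * R, vertex Q0 i -> (fun d => Z d i) @ F --> l.
  have [[k Qk]|nv] := pselect (vertex Q0 i); last by exists 0.
  have [_ _ /(_ k.+3)] := all_good _ Qk.
  by rewrite corner_sq_right => -[l hl]; exists l.
have Pex q : exists l : R * R, Q0 q -> P^~ q @ F --> l.
  have [Qq|nq] := pselect (Q0 q); last by exists 0.
  by have [_ [l hl] _] := all_good _ Qq; exists l.
have [Zl hZl] := choice Zex; have [Pl hPl] := choice Pex.
exists (fun i => Circle (Zl i) (e i)); split => //; last first.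
  by move=> i vi; split; [exact: hZl|exact: hrin|exact: hrout].
have laid q : Q0 q ->
    laid_out (role_radius eps e q) (Pl q) (fun c => Zl (corner q c)).
  move=> Qq; have [ot _ _] := all_good _ Qq.
  apply: (laid_out_lim (near_laid_out Qq ot) (fun c => @rho_at_cvg q c Qq)).
    exact: hPl.
  by move=> c; apply: hZl; exact: vertex_corner.
apply: (laid_out_circle_pattern eps1 e0 laid) => i Qi.
have vi : vertex Q0 i by exists 0%N.
have ang k : angle (P d (sq i k)) (Z d i) (P d (sq i k.+1)) @[d --> F] -->
    angle (Pl (sq i k)) (Zl i) (Pl (sq i k.+1)).
  apply: cvg_angle; [exact: hPl|exact: hZl|exact: hPl|].
  exact: (edge_turn_neq0 eps1 e0 laid).
have sum_cvg : \sum_(k < 4) angle (P d (sq i k)) (Z d i) (P d (sq i k.+1))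
    @[d --> F] --> \sum_(k < 4) angle (Pl (sq i k)) (Zl i) (Pl (sq i k.+1)).
  rewrite [X in _ --> X](_ : _ = angle (Pl (sq i 0)) (Zl i) (Pl (sq i 1)) +
    angle (Pl (sq i 1)) (Zl i) (Pl (sq i 2)) +
    angle (Pl (sq i 2)) (Zl i) (Pl (sq i 3)) +
    angle (Pl (sq i 3)) (Zl i) (Pl (sq i 4))); last first.
    by rewrite !big_ord_recr big_ord0 /= add0r.
  apply: (cvg_near_eq _ (cvgD (cvgD (cvgD (ang 0%N) (ang 1%N)) (ang 2)) (ang 3))).
  by apply: nearW => d; rewrite !big_ord_recr big_ord0 /= add0r.
apply: (cvg_eq_lim _ sum_cvg (cvg_cst (2 * pi))).
(* The vertex [i] is corner 0 of [sq i 1], an inner role, so its inner radius is eventually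
   nonzero. *)
apply: filterS (near_rho_at_neq0 (Qi 1%N)) => d /(_ 0%N).
rewrite /rho_at (corner_sq i 0) /role /= => r0.
have [ord1 ord2] := @horder d i (fun k => sub (Qi k)).
rewrite -(ring_angle_sum (fun k => sub (Qi k)) ord1 ord2 (@hturn d) r0).
by apply: eq_bigr => k _; rewrite angle_motion.
Qed.

End Family.

Lemma ring_family_limit {R : realType} (F : set_system R) {FF : ProperFilter F}
    (Q Q0 : set (int * int)) (a : R -> int * int -> ring R) (eps : R)
    (e : int * int -> R) :
  Q0 `<=` Q -> simply_connected (dual_body R Q0) ->
  (forall d, ring_pattern Q (a d)) -> eps = 1 \/ eps = -1 -> (forall i, 0 < e i) ->
  (forall i, vertex Q0 i -> rin (a d i) @[d --> F] --> eps * e i) ->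
  (forall i, vertex Q0 i -> rout (a d i) @[d --> F] --> e i) ->
  exists C : int * int -> circle R,
    [/\ circle_pattern Q0 C, (forall i, rad (C i) = e i) & ring_limit F Q0 a eps C].
Proof.
move=> sub hD hpat eps1 e0 hrin hrout.
have [q0 Qq0] : exists q0, Q0 q0.
  have [[x [m [n [s [t [Qx _ _]]]]]] _ _] := hD.
  by exists (m + 0, n + 0); exact: (Qx false false).
have pex d : exists p : int * int -> R * R, touch_points Q (a d) p /\
    (forall i, inner_vertex Q i ->
      (0 < rin (a d i) -> ccw_order (center (a d i))
        (p (sq i 0)) (p (sq i 1)) (p (sq i 2)) (p (sq i 3))) /\
      (rin (a d i) < 0 -> ccw_order (center (a d i))
        (p (sq i 3)) (p (sq i 2)) (p (sq i 1)) (p (sq i 0)))) /\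
    turns Q (a d) p.
  by have [_ [_ [p [h1 h2 h3]]]] := hpat d; exists p.
have [p hp] := choice pex.
have htouch d : touch_points Q (a d) (p d) by have [] := hp d.
have horder d := proj1 (proj2 (hp d)).
have hturn d : turns Q (a d) (p d) by have [_ []] := hp d.
have hring d i : vertex Q i -> is_ring (a d i) by have [h _] := hpat d; exact: h.
have hedge d : orthogonal_edges Q (a d) by have [_ [h _]] := hpat d; exact: h.
pose z c d := center (a d (corner q0 c)).
pose w d := z 1%N d - z 0%N d.
(* Taking the orientation of the base square as sign makes the motion reflect exactly when this is
   -1. *)
pose tau d := orient (a d) (p d) q0.
pose g d := motion (z 0%N d) (w d) (tau d).
have ww d : dot (w d) (w d) = rho_at (a d) q0 0 ^+ 2 + rho_at (a d) q0 1 ^+ 2.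
  rewrite -!(ray_sqr _ (@htouch d) (sub _ Qq0)).
  transitivity (dot (ray (a d) (p d) q0 0) (ray (a d) (p d) q0 0) +
     dot (ray (a d) (p d) q0 1) (ray (a d) (p d) q0 1) -
     2 * dot (ray (a d) (p d) q0 0) (ray (a d) (p d) q0 1)).
    by rewrite /w /z /ray /dot /=; ring.
  by rewrite (ray_perp 0 (@hedge d) (@htouch d) (sub _ Qq0)) mulr0 subr0.
(* The outer radius at corner 1 is positive for every [d], so the base edge never degenerates and
   each [g d] is a motion. *)
have w0 d : 0 < dot (w d) (w d).
  rewrite ww ltr_wpDl ?sqr_ge0 //; apply: exprn_gt0; rewrite /rho_at /role /=.
  by have [] := hring d _ (vertex_corner 1 (sub _ Qq0)).
have tau1 d : tau d = 1 \/ tau d = -1 by exact: orientP.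
have gdot d x y x' y' : dot (g d x - g d y) (g d x' - g d y') = dot (x - y) (x' - y').
  exact: motion_dot.
have gcross d x y x' y' :
    cross (g d x - g d y) (g d x' - g d y') = tau d * cross (x - y) (x' - y').
  exact: motion_cross.
have conn := simply_connected_dual_connected hD.
have c0 : converges (F := F) (fun d => g d (center (a d (corner q0 0)))).
  exists (0, 0); apply: cvg_near_cst; apply: nearW => d.
  rewrite /g /motion /z subrr; apply: injective_projections => /=.
    by rewrite /dot !mulr0 addr0 mul0r.
  by rewrite /cross !mulr0 subrr mulr0 mul0r.
(* The second base centre moves to [(enorm (w d), 0)], which depends on the radii alone. *)
have c1 : converges (F := F) (fun d => g d (center (a d (corner q0 1)))).
  pose l := role_radius eps e q0 0 ^+ 2 + role_radius eps e q0 1 ^+ 2.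
  have rc c : rho_at (a d) q0 c ^+ 2 @[d --> F] --> role_radius eps e q0 c ^+ 2.
    have h := rho_at_cvg hrin hrout (c := c) Qq0.
    exact: (cvg_comp _ _ h (@exprn_continuous _ 2 _)).
  have hl : Num.sqrt (rho_at (a d) q0 0 ^+ 2 + rho_at (a d) q0 1 ^+ 2) @[d --> F]
      --> Num.sqrt l.
    exact: (cvg_comp _ _ (cvgD (rc 0%N) (rc 1%N)) (@sqrt_continuous _ _)).
  have h2 : (Num.sqrt (rho_at (a d) q0 0 ^+ 2 + rho_at (a d) q0 1 ^+ 2), (0 : R))
      @[d --> F] --> (Num.sqrt l, (0 : R)).
    exact: (cvg_pair hl (cvg_cst (0 : R))).
  exists (Num.sqrt l, 0); apply: (cvg_near_eq _ h2).
  apply: nearW => d; rewrite -ww -/(enorm (w d)) /g /motion -/(z 1%N d) -/(w d).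
  have n0 : enorm (w d) != 0 by rewrite gt_eqF // sqrtr_gt0.
  congr pair; first by rewrite -sqr_enorm expr2 mulfK.
  by rewrite /cross [X in X - _]mulrC subrr mulr0 mul0r.
have good0 := good_of_edge sub hedge htouch eps1 e0 hrin hrout gdot gcross
  Qq0 (nearW _ (fun d => erefl (tau d))) c0 c1.
have [C [hC hrad hlim]] := family_limit sub conn hring hedge htouch hturn horder eps1 e0
  hrin hrout gdot gcross Qq0 (good0 _ _).
exists C; split => //; exists g; split => // d.
exact: motion_euclidean.
Qed.

(** * Limits of the scaled radii *)

Section RadiusLimits.
Context {R : realType}.
Implicit Types x d : R.

Lemma sqr_expRN_cvg (k : R) : k * expR (- d) ^+ 2 @[d --> +oo] --> (0 : R).
Proof.
have h : expR (- d) ^+ 2 @[d --> +oo] --> (0 : R) ^+ 2.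
  exact: (cvg_comp _ _ (@cvgr_expR R) (@exprn_continuous _ 2 _)).
by have := cvgM (cvg_cst k) h; rewrite expr0n mulr0; apply.
Qed.

(** For [0 < d] the scaled radius equals [expR x - expR (- x) * expR (- d) ^+ 2]. *)
Lemma sinh_pinfty x :
  2 * expR (- `|d|) * sinh (x + d) @[d --> +oo] --> expR x.
Proof.
have h : expR x - expR (- x) * expR (- d) ^+ 2 @[d --> +oo] --> expR x - 0.
  exact: (cvgB (cvg_cst (expR x)) (sqr_expRN_cvg (expR (- x)))).
rewrite subr0 in h; apply: (cvg_near_eq _ h).
near=> d; have d0 : 0 < d by near: d; exact: nbhs_pinfty_gt.
rewrite gtr0_norm // /sinh opprD !expRD /=.
transitivity ((expR d * expR (- d)) * expR x - expR (- x) * expR (- d) ^+ 2).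
  by rewrite expRxMexpNx_1 mul1r.
by field.
Unshelve. all: by end_near. Qed.

Lemma cosh_pinfty x :
  2 * expR (- `|d|) * cosh (x + d) @[d --> +oo] --> expR x.
Proof.
have h : expR x + expR (- x) * expR (- d) ^+ 2 @[d --> +oo] --> expR x + 0.
  exact: (cvgD (cvg_cst (expR x)) (sqr_expRN_cvg (expR (- x)))).
rewrite addr0 in h; apply: (cvg_near_eq _ h).
near=> d; have d0 : 0 < d by near: d; exact: nbhs_pinfty_gt.
rewrite gtr0_norm // /cosh opprD !expRD /=.
transitivity ((expR d * expR (- d)) * expR x + expR (- x) * expR (- d) ^+ 2).
  by rewrite expRxMexpNx_1 mul1r.
by field.
Unshelve. all: by end_near. Qed.

(** Replacing [d] by [- d] reduces this to [sinh_pinfty] at [- x]; the sign comes from [sinh] being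
    odd. *)
Lemma sinh_ninfty x :
  2 * expR (- `|d|) * sinh (x + d) @[d --> -oo] --> - expR (- x).
Proof.
apply/cvgNy_compNP; apply: (cvg_near_eq _ (cvgN (@sinh_pinfty (- x)))).
apply: nearW => d /=; rewrite normrN -mulrN; congr (_ * _).
by rewrite -[LHS]/(- sinh (- x + d)) /sinh -mulNr opprB !opprD !opprK.
Qed.

Lemma cosh_ninfty x :
  2 * expR (- `|d|) * cosh (x + d) @[d --> -oo] --> expR (- x).
Proof.
apply/cvgNy_compNP; apply: (cvg_near_eq _ (@cosh_pinfty (- x))).
apply: nearW => d /=; rewrite normrN; congr (_ * _).
by rewrite /cosh addrC !opprD !opprK.
Qed.

End RadiusLimits.

Theorem corollary3p1 (R : realType) (Q : set (int * int))
    (rho : int * int -> R) (a : R -> int * int -> ring R)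
    (hG : simply_connected (body R Q))
    (hGdual : simply_connected (dual_body R Q))
    (hpattern : forall delta : R, ring_pattern Q (a delta))
    (hrin : forall (delta : R) (i : int * int), vertex Q i ->
       rin (a delta i) = 2 * expR (- `|delta|) * sinh (rho i + delta))
    (hrout : forall (delta : R) (i : int * int), vertex Q i ->
       rout (a delta i) = 2 * expR (- `|delta|) * cosh (rho i + delta))
    (Q0 : set (int * int)) (hsub : Q0 `<=` Q)
    (hcompact : compact (body R Q0))
    (hG0 : simply_connected (body R Q0))
    (hG0dual : simply_connected (dual_body R Q0)) :
  exists C D : int * int -> circle R,
    [/\ circle_pattern Q0 C, log_radii Q0 C rho &
        ring_limit (pinfty_nbhs R) Q0 a 1 C] /\
    [/\ dual_pattern Q0 C D, log_radii Q0 D (fun i => - rho i) &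
        ring_limit (ninfty_nbhs R) Q0 a (- 1) D].
Proof.
have vQ i : vertex Q0 i -> vertex Q i by move=> [k /hsub Qk]; exists k.
have rin_lim F (l : R) i : vertex Q0 i ->
    2 * expR (- `|d|) * sinh (rho i + d) @[d --> F] --> l ->
    rin (a d i) @[d --> F] --> l.
  by move=> /vQ vi; rewrite (_ : (fun d => rin (a d i)) =
    fun d => 2 * expR (- `|d|) * sinh (rho i + d)) //; apply/funext => d; exact: hrin.
have rout_lim F (l : R) i : vertex Q0 i ->
    2 * expR (- `|d|) * cosh (rho i + d) @[d --> F] --> l ->
    rout (a d i) @[d --> F] --> l.
  by move=> /vQ vi; rewrite (_ : (fun d => rout (a d i)) =
    fun d => 2 * expR (- `|d|) * cosh (rho i + d)) //; apply/funext => d; exact: hrout.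
have [C [hC radC limC]] : exists C : int * int -> circle R, [/\ circle_pattern Q0 C,
    (forall i, rad (C i) = expR (rho i)) & ring_limit (pinfty_nbhs R) Q0 a 1 C].
  apply: (ring_family_limit hsub hG0dual hpattern).
  - by left.
  - by move=> i; exact: expR_gt0.
  - by move=> i vi; rewrite mul1r; apply: rin_lim vi (@sinh_pinfty _ _).
  - by move=> i vi; apply: rout_lim vi (@cosh_pinfty _ _).
have [D [hD radD limD]] : exists D : int * int -> circle R, [/\ circle_pattern Q0 D,
    (forall i, rad (D i) = expR (- rho i)) & ring_limit (ninfty_nbhs R) Q0 a (- 1) D].
  apply: (ring_family_limit hsub hG0dual hpattern).
  - by right.
  - by move=> i; exact: expR_gt0.
  - by move=> i vi; rewrite mulN1r; apply: rin_lim vi (@sinh_ninfty _ _).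
  - by move=> i vi; apply: rout_lim vi (@cosh_ninfty _ _).
exists C, D; split; split => //; split => // rho' hrho' i vi.
(* Any logarithmic radii of [C] agree with [rho] on the vertices, as [expR] is injective. *)
by rewrite radD; congr expR; congr (- _); apply: expR_inj; rewrite -radC hrho'.
Qed.
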